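(* Let $n\ge 1$ and let $\varphi=(\varphi_1,\dots,\varphi_n)$ and $\psi=(\psi_1,\dots,\psi_n)$ be holomorphic self-maps of the unit polydisc $U^n\subset\mathbb{C}^n$. Consider the operator $C_\varphi-C_\psi: H^\infty(U^n)\to H^\infty(U^n)$. Set $$L:=\lim_{\delta\to 0^+}\ \sup_{z\in E_\delta}\ \max_{1\le j\le n}\beta(\varphi_j(z),\psi_j(z)).$$ Then $$L\ \le\ \|C_\varphi-C_\psi\|_e\ \le\ \frac{4-4\sqrt{1-L^2}}{L},$$ where the right-hand side is interpreted as $0$ when $L=0$.
   Context: $D$ is the open unit disc in $\mathbb{C}$ and $U^n=D^n$ is the open unit polydisc in $\mathbb{C}^n$. $H^\infty(U^n)$ is the Banach space of bounded holomorphic functions $f:U^n\to\mathbb{C}$ with the sup norm $\|f\|_\infty$. For a holomorphic self-map $\varphi:U^n\to U^n$, the composition operator is $C_\varphi f=f\circ\varphi$ (and similarly $C_\psi f=f\circ\psi$). The pseudo-hyperbolic distance on $D$ is $\beta(z,w)=\left|\frac{z-w}{1-\overline{z}w}\right|$. The essential norm of a bounded linear operator $T$ on $H^\infty(U^n)$ is $\|T\|_e=\inf\{\|T-K\|: K \text{ a compact linear operator on } H^\infty(U^n)\}$. For $0<\delta<1$ and $1\le j\le n$, $E^j_\delta=\{z\in U^n:\max(|\varphi_j(z)|,|\psi_j(z)|)>1-\delta\}$, and $E_\delta=\bigcup_{j=1}^n E^j_\delta$. Convention: if $E_\delta=\emptyset$ for all sufficiently small $\delta$ (i.e. $\|\varphi_j\|_\infty<1$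 and $\|\psi_j\|_\infty<1$ for all $j$), the limit $L$ is taken to be $0$. *)

(* Defs.v *)
From HB Require Import structures.
From mathcomp Require Import all_boot all_order all_algebra.
From mathcomp Require Import complex ring.
From mathcomp Require Import all_classical all_reals all_analysis.

Set Implicit Arguments.
Unset Strict Implicit.
Unset Printing Implicit Defensive.

Import Order.TTheory GRing.Theory Num.Theory.
Import numFieldNormedType.Exports.

Local Open Scope classical_set_scope.
Local Open Scope ring_scope.
Local Open Scope complex_scope.

(* The topology and normed module structure that every numFieldType [K] carries
   through [K^o], here for the concrete field of complex numbers. *)
HB.instance Definition _ (R : rcfType) := GRing.ComAlgebra.copy R[i] R[i]^o.
HB.instance Definition _ (R : rcfType) := Vector.copy R[i] R[i]^o.
HB.instance Definition _ (R : rcfType) := NormedModule.copy R[i] R[i]^o.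

(* The norm of a normed module over R[i] takes its values in R[i]; [rnorm x] is
   the same norm seen as an element of R. *)
Definition rnorm (R : realType) (V : normedModType R[i]) (x : V) : R :=
  complex.Re `|x|.

Section Polydisc.
Variables (R : realType) (n : nat).
Local Notation C := (R[i]).
Local Notation Cn := 'rV[R[i]]_n.

Definition polydisc : set Cn := [set z : Cn | forall j, `|z ord0 j| < 1].

Definition holomorphic_on_polydisc (W : normedModType C) (f : Cn -> W) : Prop :=
  forall z, polydisc z -> differentiable f z.

Record polydisc_selfmap := PolydiscSelfmap {
  selfmap_fun :> Cn -> Cn;
  selfmap_polydisc : forall z, polydisc z -> polydisc (selfmap_fun z);
  selfmap_holo : holomorphic_on_polydisc selfmap_fun }.

(* A bounded holomorphic function on the polydisc is represented by its extension
   by 0 to C^n, so that equality in [Hinf] is equality on the polydisc. *)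
Definition Hinf_axiom (f : Cn -> C) : Prop :=
  [/\ holomorphic_on_polydisc f,
      (exists M : R, forall z, polydisc z -> rnorm (f z) <= M) &
      forall z, ~ polydisc z -> f z = 0].

Definition Hinf_pred : {pred Cn -> C} := fun f => `[< Hinf_axiom f >].

Record Hinf := MkHinf { Hinf_val :> Cn -> C; _ : Hinf_val \in Hinf_pred }.

HB.instance Definition _ := [isSub for Hinf_val].
HB.instance Definition _ := [Choice of Hinf by <:].

Lemma HinfP (f : Hinf) : Hinf_axiom f.
Proof. by case: f => f /= /asboolP. Qed.

Lemma rnormE (V : normedModType C) (x : V) : (rnorm x)%:C = `|x|.
Proof. by rewrite /rnorm RRe_real. Qed.

Lemma rnorm_ge0 (V : normedModType C) (x : V) : 0 <= rnorm x.
Proof. by rewrite -lecR rnormE normr_ge0. Qed.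

Lemma ler_rnormD (V : normedModType C) (x y : V) :
  rnorm (x + y) <= rnorm x + rnorm y.
Proof. by rewrite -lecR rmorphD/= !rnormE ler_normD. Qed.

Lemma rnormZ (V : normedModType C) (a : C) (x : V) :
  rnorm (a *: x) = rnorm a * rnorm x.
Proof. by apply: (@complexI R); rewrite rmorphM/= !rnormE normrZ. Qed.

Lemma rnorm0 (V : normedModType C) : rnorm (0 : V) = 0.
Proof. by apply: (@complexI R); rewrite rnormE normr0. Qed.

Lemma rnorm0_eq0 (V : normedModType C) (x : V) : rnorm x = 0 -> x = 0.
Proof. by move=> x0; apply/normr0_eq0; rewrite -rnormE x0. Qed.

Fact Hinf_submod_closed : submod_closed Hinf_pred.
Proof.
split=> [|a f g /asboolP[hf [Mf bf] f0] /asboolP[hg [Mg bg] g0]].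
  apply/asboolP; split=> [z _||//]; first exact: differentiable_cst.
  by exists 0 => z _; rewrite rnorm0.
apply/asboolP; split=> [z Dz||z Dz].
- by apply: differentiableD; [apply: differentiableZ; exact: hf|exact: hg].
- exists (rnorm a * Mf + Mg) => z Dz.
  rewrite (le_trans (ler_rnormD _ _))// lerD ?bg// rnormZ.
  by rewrite ler_wpM2l ?rnorm_ge0// bf.
- by rewrite -[LHS]/(a *: f z + g z) f0// g0// scaler0 addr0.
Qed.
HB.instance Definition _ :=
  GRing.isSubmodClosed.Build _ _ Hinf_pred Hinf_submod_closed.
HB.instance Definition _ := [SubChoice_isSubLmodule of Hinf by <:].

Definition Hinf_norm (f : Hinf) : R := sup [set rnorm (f z) | z in polydisc].

Lemma polydisc0 : polydisc 0.
Proof. by move=> j; rewrite mxE normr0. Qed.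

Lemma Hinf_norm_ub (f : Hinf) z : rnorm (f z) <= Hinf_norm f.
Proof.
have [_ [M fM] f0] := HinfP f.
have ub : has_ubound [set rnorm (f z) | z in polydisc].
  by exists M => _ [w Dw <-]; exact: fM.
have [Dz|Dz] := pselect (polydisc z); first by apply: ub_le_sup => //; exists z.
rewrite f0// rnorm0 (le_trans (rnorm_ge0 (f 0)))//.
by apply: ub_le_sup => //; exists 0 => //; exact: polydisc0.
Qed.

Lemma Hinf_norm_le (f : Hinf) M :
  (forall z, polydisc z -> rnorm (f z) <= M) -> Hinf_norm f <= M.
Proof.
move=> fM; apply: ge_sup; first by exists (rnorm (f 0)), 0 => //; exact: polydisc0.
by move=> _ [z Dz <-]; exact: fM.
Qed.

Fact ler_Hinf_normD (f g : Hinf) :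
  (Hinf_norm (f + g))%:C <= (Hinf_norm f)%:C + (Hinf_norm g)%:C.
Proof.
rewrite -rmorphD lecR; apply: Hinf_norm_le => z _.
by rewrite (le_trans (ler_rnormD _ _))// lerD ?Hinf_norm_ub.
Qed.

Fact Hinf_normZ (a : C) (f : Hinf) :
  (Hinf_norm (a *: f))%:C = `|a| * (Hinf_norm f)%:C.
Proof.
rewrite -rnormE -rmorphM; congr (_%:C).
have le_Z b g : Hinf_norm (b *: g) <= rnorm b * Hinf_norm g.
  apply: Hinf_norm_le => z _.
  by rewrite /= rnormZ ler_wpM2l ?rnorm_ge0 ?Hinf_norm_ub.
apply/eqP; rewrite eq_le le_Z/=; have [->|a0] := eqVneq a 0.
  rewrite rnorm0 mul0r (le_trans (rnorm_ge0 ((0 *: f : Hinf) 0)))//.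
  exact: Hinf_norm_ub.
rewrite -{1}(scalerK a0 f) (le_trans (ler_wpM2l (rnorm_ge0 a) (le_Z _ _)))//.
rewrite mulrA (_ : rnorm a * _ = 1) ?mul1r//.
by apply: (@complexI R); rewrite rmorphM/= !rnormE -normrM divff// normr1.
Qed.

Fact Hinf_norm0_eq0 (f : Hinf) : (Hinf_norm f)%:C = 0 -> f = 0.
Proof.
move=> /complexI f0; apply/val_inj/funext => z; apply: rnorm0_eq0.
by apply/eqP; rewrite eq_le rnorm_ge0 andbT -f0; exact: Hinf_norm_ub.
Qed.

HB.instance Definition _ :=
  Lmodule_isNormed.Build C Hinf ler_Hinf_normD Hinf_normZ Hinf_norm0_eq0.

Lemma polydisc_open : open polydisc.
Proof.
suff -> : polydisc = ball (0 : Cn) 1 by exact: ball_open.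
apply/seteqP; split=> [z Dz|z [_ Dz] j].
  by split=> // i j; rewrite /ball/= !mxE sub0r normrN (ord1 i); exact: Dz.
by have := Dz ord0 j; rewrite /ball/= !mxE sub0r normrN.
Qed.

Lemma near_eq_differentiable (W : normedModType C) (f g : Cn -> W) z :
  (\forall w \near z, f w = g w) -> differentiable f z -> differentiable g z.
Proof.
move=> fg /diff_locallyP[dfc dfz].
have gz : g \o shift z = cst (g z) + 'd f z +o_ (0 : Cn) id.
  move: dfz => /eqaddoP dfz; apply/eqaddoP => e /dfz dfe.
  have fg0 : \forall h \near (0 : Cn), f (h + z) = g (h + z).
    by rewrite (near_shift z)/= sub0r; near=> w; rewrite /= subrK; near: w.
  near=> h.
  have <- : (f \o shift z - (cst (f z) + 'd f z)) h =
            (g \o shift z - (cst (g z) + 'd f z)) h.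
    rewrite !fctE (nbhs_singleton fg); congr (_ - _).
    by near: h.
  by near: h.
apply/diff_locallyP; rewrite (diff_unique dfc gz); split=> //.
Unshelve. all: by end_near. Qed.

Definition comp_fun (phi : polydisc_selfmap) (f : Cn -> C) : Cn -> C :=
  patch (fun=> 0) polydisc (f \o phi).

Fact comp_funP (phi : polydisc_selfmap) (f : Hinf) :
  comp_fun phi f \in Hinf_pred.
Proof.
have [hf [M fM] _] := HinfP f; apply/asboolP; split=> [z Dz||z Dz].
- apply: (@near_eq_differentiable _ (f \o phi)).
    near=> w; rewrite /comp_fun/patch mem_set//; near: w.
    exact: polydisc_open.
  apply: differentiable_comp; first exact: selfmap_holo.
  exact/hf/selfmap_polydisc.
- by exists M => z Dz; rewrite /comp_fun/patch mem_set//; exact/fM/selfmap_polydisc.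
- by rewrite /comp_fun/patch memNset.
Unshelve. all: by end_near. Qed.

Definition comp_op (phi : polydisc_selfmap) (f : Hinf) : Hinf :=
  MkHinf (comp_funP phi f).

Fact comp_op_linear (phi : polydisc_selfmap) : linear (comp_op phi).
Proof.
move=> a f g; apply/val_inj/funext => z /=.
rewrite -[RHS]/(a *: comp_fun phi f z + comp_fun phi g z) /comp_fun /patch.
by case: ifP => // _; rewrite scaler0 addr0.
Qed.
HB.instance Definition _ (phi : polydisc_selfmap) :=
  GRing.isLinear.Build C Hinf Hinf _ (comp_op phi) (comp_op_linear phi).

End Polydisc.

Section EssentialNorm.
Variables (R : realType) (V W : normedModType R[i]).

Definition compact_op (T : V -> W) : Prop :=
  precompact (T @` [set x | `|x| <= 1]).

(* Valued in the extended reals, so that an unbounded [T] gets the value +oo. *)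
Definition op_norm (T : V -> W) : \bar R :=
  ereal_sup [set (rnorm (T x))%:E | x in [set x | `|x| <= 1]].

Definition ess_norm (T : V -> W) : \bar R :=
  ereal_inf [set op_norm (T \- K) | K in [set K : {linear V -> W} | compact_op K]].

End EssentialNorm.

Section BoundaryLimit.
Variables (R : realType) (n : nat) (phi psi : polydisc_selfmap R n).

Definition ph_dist (z w : R[i]) : R := rnorm ((z - w) / (1 - z^* * w)).

Definition Edelta_j (j : 'I_n) (d : R) : set 'rV[R[i]]_n :=
  [set z : 'rV[R[i]]_n | polydisc z /\
    1 - d < Num.max (rnorm (phi z ord0 j)) (rnorm (psi z ord0 j))].

Definition Edelta (d : R) : set 'rV[R[i]]_n := \bigcup_(j in setT) Edelta_j j d.

Definition max_dist (z : 'rV[R[i]]_n) : R :=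
  \big[Num.max/0]_(j < n) ph_dist (phi z ord0 j) (psi z ord0 j).

(* [sup set0] is 0, which is the convention wanted when [Edelta d] is empty. *)
Definition sup_dist (d : R) : R := sup [set max_dist z | z in Edelta d].

(* The limit exists: see [is_cvg_sup_dist] below. *)
Definition lim_dist : R := lim (sup_dist d @[d --> 0^'+]).

Lemma ph_dist_le1 (z w : R[i]) : `|z| < 1 -> `|w| < 1 -> ph_dist z w <= 1.
Proof.
move=> z1 w1; rewrite -lecR rnormE normrM normfV.
have sq : `|z - w| ^+ 2 <= `|1 - z^* * w| ^+ 2.
  have eq : `|1 - z^* * w| ^+ 2 - `|z - w| ^+ 2 =
      (1 - `|z| ^+ 2) * (1 - `|w| ^+ 2).
    by rewrite !normCK !rmorphB !rmorphM rmorph1/= conjCK; ring.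
  by rewrite -subr_ge0 eq mulr_ge0// subr_ge0 exprn_ile1// ltW.
have le : `|z - w| <= `|1 - z^* * w| by rewrite -(@ler_pXn2r _ 2).
have [->|d0] := eqVneq (1 - z^* * w) 0; first by rewrite normr0 invr0 mulr0.
by rewrite ler_pdivrMr ?normr_gt0// mul1r.
Qed.

Lemma max_dist_ge0 z : 0 <= max_dist z.
Proof. by rewrite /max_dist bigmax_idl le_max lexx. Qed.

Lemma max_dist_le1 z : polydisc z -> max_dist z <= 1.
Proof.
move=> Dz; apply/bigmax_leP; split=> // j _.
by apply: ph_dist_le1; apply: selfmap_polydisc.
Qed.

Lemma is_cvg_sup_dist : cvg (sup_dist d @[d --> 0^'+]).
Proof.
have ub d : has_ubound [set max_dist z | z in Edelta d].
  by exists 1 => _ [z [j _ [Dz _]] <-]; exact: max_dist_le1.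
have ge0 d : 0 <= sup_dist d.
  have [E0|/set0P[z Ez]] := eqVneq (Edelta d) set0.
    by rewrite /sup_dist E0 image_set0 sup0.
  by apply: (le_trans (max_dist_ge0 z)); apply: ub_le_sup => //; exists z.
apply: nondecreasing_at_right_is_cvgr; near=> x; last first.
  by exists 0 => _ [d _ <-].
move=> d1 d2 _ _ d12.
have [E0|/set0P[z Ez]] := eqVneq (Edelta d1) set0.
  by rewrite {1}/sup_dist E0 image_set0 sup0.
apply: ge_sup; first by exists (max_dist z), z.
move=> _ [w [j _ [Dw dw]] <-]; apply: ub_le_sup => //; exists w => //.
by exists j => //; split=> //; rewrite (le_lt_trans _ dw)// lerB.
Unshelve. all: by end_near. Qed.

End BoundaryLimit.

(* Main.v *)
Require Import Defs.
From HB Require Import structures.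
From mathcomp Require Import all_boot all_order all_algebra.
From mathcomp Require Import complex ring lra.
From mathcomp Require Import all_classical all_reals all_analysis.

Set Implicit Arguments.
Unset Strict Implicit.
Unset Printing Implicit Defensive.

Import Order.TTheory GRing.Theory Num.Theory.
Import numFieldNormedType.Exports.

Local Open Scope classical_set_scope.
Local Open Scope ring_scope.
Local Open Scope complex_scope.

(** Upper bound.  For r < 1 put K f = f o (r phi) - f o (r psi).  The images of
    r phi and r psi stay in the polydisc of radius r, so K is compact by Montel's
    theorem ([montel], [compact_op_interior]).  For f in the unit ball,
    ((C_phi - C_psi - K) f)(z) is f(phi z) - f(psi z) minus the same difference
    for w |-> f (r w).  If z lies in E_d, the Schwarz-Pick lemma on an analytic
    disc joining phi z to psi z ([polydisc_gap]) bounds each difference by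
    [gap] (max_j beta (phi_j z, psi_j z)), where [gap] r = 2 r / (1 + sqrt (1 - r^2))
    is the largest Euclidean distance between points of the disc at
    pseudo-hyperbolic distance r.  If z is not in E_d, both phi z and psi z stay
    away from the boundary, so f hardly changes between phi z and r phi z once r
    is close to 1 ([dilate_move]).  Letting r tend to 1 and then d to 0 leaves
    2 [gap] L = (4 - 4 sqrt (1 - L^2)) / L.

    Lower bound.  Given M < L, compactness of the closed disc provides a
    coordinate l and a boundary point u such that points z with
    max_j beta (phi_j z, psi_j z) > M have phi_l z or psi_l z as close to u as
    desired ([boundary_cluster]).  The test functions are products of a function
    of z_l with modulus at most 1, almost 1 at that point and tiny both closer to
    u and farther from u ([peak]), and of a disc automorphism in z_j that vanishes
    at the other image point ([test_function]).  A compact K maps two of them, f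
    and g, to nearly the same function, and g may be taken to live much closer to
    u than f ([separated_pair]); then f - g has norm nearly 1, K (f - g) is nearly
    0, and (C_phi - C_psi)(f - g) has norm at least nearly M.

    Complex analysis starts from bare complex differentiability: Goursat's
    bisection ([closed_form_rectint0]) in logarithmic polar coordinates gives the
    mean value property in the weak form [no_peak], hence the maximum principle
    and Schwarz's lemma; Montel's theorem follows from Schwarz's lemma and
    ultrafilters, without power series. *)

(** * Goursat's theorem for differentiable closed forms *)

Section Goursat.
Variable R : realType.
Local Notation mu := (@lebesgue_measure R).

Definition segint (g : R -> R) (a b : R) : R := \int[mu]_(x in `[a, b]) g x.

Definition cont_on (g : R -> R) (a b : R) : Prop := {in `[a, b], continuous g}.

Lemma cont_onB (g h : R -> R) a b :
  cont_on g a b -> cont_on h a b -> cont_on (g \- h) a b.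
Proof. by move=> cg ch x xab; apply: continuousB; [exact: cg|exact: ch]. Qed.

Lemma integrable_cont_on (g : R -> R) a b :
  cont_on g a b -> mu.-integrable `[a, b] (EFin \o g).
Proof.
move=> cg; apply: continuous_compact_integrable; first exact: segment_compact.
by apply: continuous_in_subspaceT => x; rewrite inE; exact: cg.
Qed.

Lemma segintD (g h : R -> R) a b : cont_on g a b -> cont_on h a b ->
  segint (g \+ h) a b = segint g a b + segint h a b.
Proof. by move=> cg ch; rewrite /segint RintegralD//; exact: integrable_cont_on. Qed.

Lemma segint_split (g : R -> R) a m b : a <= m -> m <= b -> cont_on g a b ->
  segint g a b = segint g a m + segint g m b.
Proof.
move=> am mb cg.
have := @Rintegral_itvB R g (BLeft a) (BRight b) m (integrable_cont_on cg).
rewrite !bnd_simp => /(_ am mb); rewrite Rintegral_itv_obnd_cbnd; last first.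
  apply: integrableS (integrable_cont_on cg) => //.
  by apply: subset_itv; rewrite bnd_simp.
by move=> /eqP; rewrite subr_eq addrC => /eqP.
Qed.

Lemma segint_cst (k : R) a b : a <= b -> segint (fun=> k) a b = k * (b - a).
Proof.
move=> ab; rewrite /segint Rintegral_cst//= lebesgue_measure_itv/= lte_fin.
case: ltrP => [_|ba] //=; congr (_ * _).
by apply/eqP; rewrite eq_sym subr_eq0 eq_le ab ba.
Qed.

Lemma segint_le (g : R -> R) a b k : a <= b -> cont_on g a b ->
  (forall x, a <= x <= b -> g x <= k) -> segint g a b <= k * (b - a).
Proof.
move=> ab cg gk; rewrite -segint_cst//; apply: le_Rintegral; first exact: measurable_itv.
- exact: integrable_cont_on.
- by apply: integrable_cont_on => x _; exact: cst_continuous.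
- by move=> x /=; rewrite in_itv/=; exact: gk.
Qed.

Lemma segint_ge (g : R -> R) a b k : a <= b -> cont_on g a b ->
  (forall x, a <= x <= b -> k <= g x) -> k * (b - a) <= segint g a b.
Proof.
move=> ab cg gk; rewrite -segint_cst//; apply: le_Rintegral; first exact: measurable_itv.
- by apply: integrable_cont_on => x _; exact: cst_continuous.
- exact: integrable_cont_on.
- by move=> x /=; rewrite in_itv/=; exact: gk.
Qed.

Lemma segint_norm (g : R -> R) a b k m : a <= b -> cont_on g a b ->
  (forall x, a <= x <= b -> `|g x - m| <= k) ->
  `|segint g a b - m * (b - a)| <= k * (b - a).
Proof.
move=> ab cg gk; have gk' x : a <= x <= b -> m - k <= g x <= m + k.
  by move=> /gk; rewrite ler_distl.
rewrite ler_distl -!mulrBl -mulrDl segint_ge ?segint_le// => x /gk' /andP[]//.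
Qed.

(** The integral of P dx + Q dy along the boundary of [a, b] x [c, d], opposite
    sides being grouped so that local estimates bear on increments of P and Q. *)
Definition rectint (P Q : R -> R -> R) (a b c d : R) : R :=
  segint (fun x => P x c - P x d) a b + segint (fun y => Q b y - Q a y) c d.

Definition in_rect (a b c d x y : R) : Prop := a <= x <= b /\ c <= y <= d.

Definition affine_at (P : R -> R -> R) (x0 y0 px py : R) : Prop :=
  forall e, 0 < e -> exists2 r, 0 < r & forall x y,
    `|x - x0| <= r -> `|y - y0| <= r ->
    `|P x y - P x0 y0 - (px * (x - x0) + py * (y - y0))| <=
      e * (`|x - x0| + `|y - y0|).

(** Closedness at a point: the y-derivative of P and the x-derivative of Q are
    the same number k. *)
Definition closed_form_at (P Q : R -> R -> R) (x0 y0 : R) : Prop :=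
  exists px k qy, affine_at P x0 y0 px k /\ affine_at Q x0 y0 k qy.

Lemma affine_cont1 P x0 y0 px py : affine_at P x0 y0 px py ->
  {for x0, continuous (P^~ y0)}.
Proof.
move=> aP; have [r r0 rP] := aP _ ltr01.
apply/cvgrPdist_lt => e e0.
pose M := 1 + `|px|; have M0 : 0 < M by rewrite /M ltr_wpDr.
near=> x.
have xr : `|x - x0| <= r.
  by rewrite distrC ltW//; near: x; apply/nbhs_ballP; exists r.
have xe : `|x - x0| < e / M.
  by rewrite distrC; near: x; apply/nbhs_ballP; exists (e / M) => //=; exact: divr_gt0.
have := rP x y0 xr; rewrite subrr normr0 mulr0 !addr0 mul1r.
move=> /(_ (ltW r0)) le1; rewrite distrC.
have le2 : `|P x y0 - P x0 y0| <= M * `|x - x0|.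
  rewrite /M mulrDl mul1r -normrM -lerBlDr (le_trans _ le1)//.
  exact: lerB_dist.
by rewrite (le_lt_trans le2)// mulrC -ltr_pdivlMr.
Unshelve. all: by end_near. Qed.

Lemma affine_cont2 P x0 y0 px py : affine_at P x0 y0 px py ->
  {for y0, continuous (P x0)}.
Proof.
move=> aP; apply: (@affine_cont1 (fun y x => P x y) y0 x0 py px).
move=> e /aP[r r0 rP]; exists r => // x y xr yr.
by rewrite [_ * _ + _]addrC [`|x - _| + _]addrC; exact: rP.
Qed.

Section ClosedForm.
Variables (P Q : R -> R -> R).

Definition closed_on (a b c d : R) : Prop :=
  forall x y, in_rect a b c d x y -> closed_form_at P Q x y.

Lemma closed_onS a b c d a' b' c' d' : a <= a' -> b' <= b -> c <= c' -> d' <= d ->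
  closed_on a b c d -> closed_on a' b' c' d'.
Proof.
move=> aa bb cc dd cl x y [/andP[? ?] /andP[? ?]]; apply: cl; split.
  by apply/andP; split; lra.
by apply/andP; split; lra.
Qed.

Lemma closed_on_contP a b c d y : closed_on a b c d -> c <= y <= d ->
  cont_on (P^~ y) a b.
Proof.
move=> cl yI x; rewrite in_itv/= => xI.
by have [px [k [qy [aP _]]]] := cl x y (conj xI yI); exact: affine_cont1 aP.
Qed.

Lemma closed_on_contQ a b c d x : closed_on a b c d -> a <= x <= b ->
  cont_on (Q x) c d.
Proof.
move=> cl xI y; rewrite in_itv/= => yI.
by have [px [k [qy [_ aQ]]]] := cl x y (conj xI yI); exact: affine_cont2 aQ.
Qed.

Lemma rectint_splitx a m b c d : a <= m <= b -> c <= d -> closed_on a b c d ->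
  rectint P Q a b c d = rectint P Q a m c d + rectint P Q m b c d.
Proof.
move=> /andP[am mb] cd cl; rewrite /rectint.
have cP y : c <= y <= d -> cont_on (P^~ y) a b by exact: closed_on_contP.
have cQ x : a <= x <= b -> cont_on (Q x) c d by exact: closed_on_contQ.
have Ic : c <= c <= d by rewrite lexx.
have Id : c <= d <= d by rewrite lexx andbT.
have Ia : a <= a <= b by rewrite lexx (le_trans am).
have Ib : a <= b <= b by rewrite lexx andbT (le_trans am).
have Im : a <= m <= b by rewrite am.
rewrite (segint_split am mb); last by apply: cont_onB; exact: cP.
have -> : segint (fun y => Q b y - Q a y) c d =
    segint (fun y => Q m y - Q a y) c d + segint (fun y => Q b y - Q m y) c d.
  rewrite -segintD; try by apply: cont_onB; exact: cQ.
  by congr segint; apply/funext => y /=; ring.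
by ring.
Qed.

Lemma rectint_splity a b c m d : a <= b -> c <= m <= d -> closed_on a b c d ->
  rectint P Q a b c d = rectint P Q a b c m + rectint P Q a b m d.
Proof.
move=> ab /andP[cm md] cl; rewrite /rectint.
have cP y : c <= y <= d -> cont_on (P^~ y) a b by exact: closed_on_contP.
have cQ x : a <= x <= b -> cont_on (Q x) c d by exact: closed_on_contQ.
have Ic : c <= c <= d by rewrite lexx (le_trans cm).
have Id : c <= d <= d by rewrite lexx andbT (le_trans cm).
have Im : c <= m <= d by rewrite cm.
have Ia : a <= a <= b by rewrite lexx.
have Ib : a <= b <= b by rewrite lexx andbT.
rewrite (segint_split cm md); last by apply: cont_onB; exact: cQ.
have -> : segint (fun y => P y c - P y d) a b =
    segint (fun y => P y c - P y m) a b + segint (fun y => P y m - P y d) a b.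
  rewrite -segintD; try by apply: cont_onB; exact: cP.
  by congr segint; apply/funext => y /=; ring.
by ring.
Qed.

(** The comparison quantity is additive under cutting into four equal quarters,
    whatever the shape of the rectangle. *)
Definition bad (e : R) (a b c d : R) : Prop :=
  [/\ a <= b, c <= d & e * ((b - a) + (d - c)) ^+ 2 < `|rectint P Q a b c d|].

Lemma bad_quarter e a b c d : closed_on a b c d -> bad e a b c d ->
  exists a' b' c' d', [/\ bad e a' b' c' d',
    a <= a' /\ b' <= b, c <= c' /\ d' <= d,
    b' - a' = (b - a) / 2 & d' - c' = (d - c) / 2].
Proof.
move=> cl [ab cd]; set m := (a + b) / 2; set n := (c + d) / 2.
have Im : a <= m <= b by rewrite /m; apply/andP; split; lra.
have In : c <= n <= d by rewrite /n; apply/andP; split; lra.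
have [am mb] := andP Im; have [cn nd] := andP In.
have cl1 : closed_on a m c d by apply: closed_onS cl.
have cl2 : closed_on m b c d by apply: closed_onS cl.
rewrite (rectint_splitx Im)// (rectint_splity _ In cl1)// (rectint_splity _ In cl2)//.
set r1 := rectint _ _ _ _ _ _; set r2 := rectint _ _ _ _ _ _.
set r3 := rectint _ _ _ _ _ _; set r4 := rectint _ _ _ _ _ _ => big.
set q := e * ((b - a) / 2 + (d - c) / 2) ^+ 2.
have q4 : e * ((b - a) + (d - c)) ^+ 2 = 4 * q by rewrite /q; field.
have hm1 : m - a = (b - a) / 2 by rewrite /m; field.
have hm2 : b - m = (b - a) / 2 by rewrite /m; field.
have hn1 : n - c = (d - c) / 2 by rewrite /n; field.
have hn2 : d - n = (d - c) / 2 by rewrite /n; field.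
have [h1|h1] := ltP q `|r1|.
  by exists a, m, c, n; split=> //; split=> //; rewrite hm1 hn1.
have [h2|h2] := ltP q `|r2|.
  by exists a, m, n, d; split=> //; split=> //; rewrite hm1 hn2.
have [h3|h3] := ltP q `|r3|.
  by exists m, b, c, n; split=> //; split=> //; rewrite hm2 hn1.
have [h4|h4] := ltP q `|r4|.
  by exists m, b, n, d; split=> //; split=> //; rewrite hm2 hn2.
have := le_lt_trans (lexx _) big; rewrite q4 ltNge.
suff -> : `|r1 + r2 + (r3 + r4)| <= 4 * q by [].
have := ler_normD (r1 + r2) (r3 + r4); have := ler_normD r1 r2.
have := ler_normD r3 r4; lra.
Qed.

(** Replacing P and Q by their affine parts at (x, y), the integral is
    - k h w + k w h = 0, and the error terms are small compared with the squared
    half-perimeter. *)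
Lemma not_bad_at e x y : 0 < e -> closed_form_at P Q x y ->
  exists2 r, 0 < r & forall a b c d, closed_on a b c d -> in_rect a b c d x y ->
    b - a <= r -> d - c <= r -> ~ bad e a b c d.
Proof.
move=> e0 [px [k [qy [aP aQ]]]].
have e4 : 0 < e / 2 by rewrite divr_gt0.
have [r1 r10 P1] := aP _ e4; have [r2 r20 Q1] := aQ _ e4.
exists (Num.min r1 r2); first by rewrite lt_min r10.
move=> a b c d cl [/andP[ax xb] /andP[cy yd]].
rewrite !le_min => /andP[ba1 ba2] /andP[dc1 dc2] [ab cd].
set w := b - a; set h := d - c; apply/negP; rewrite -leNgt.
have Pn u v : a <= u <= b -> c <= v <= d ->
    `|P u v - P x y - (px * (u - x) + k * (v - y))| <= e / 2 * (w + h).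
  move=> /andP[au ub] /andP[cv vd].
  have ux : `|u - x| <= w by rewrite ler_norml /w; apply/andP; split; lra.
  have vy : `|v - y| <= h by rewrite ler_norml /h; apply/andP; split; lra.
  apply: le_trans (P1 u v (le_trans ux ba1) (le_trans vy dc1)) _.
  by rewrite ler_pM2l// lerD.
have Qn u v : a <= u <= b -> c <= v <= d ->
    `|Q u v - Q x y - (k * (u - x) + qy * (v - y))| <= e / 2 * (w + h).
  move=> /andP[au ub] /andP[cv vd].
  have ux : `|u - x| <= w by rewrite ler_norml /w; apply/andP; split; lra.
  have vy : `|v - y| <= h by rewrite ler_norml /h; apply/andP; split; lra.
  apply: le_trans (Q1 u v (le_trans ux ba2) (le_trans vy dc2)) _.
  by rewrite ler_pM2l// lerD.
have Ic : c <= c <= d by rewrite lexx.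
have Id : c <= d <= d by rewrite lexx andbT.
have Ia : a <= a <= b by rewrite lexx.
have Ib : a <= b <= b by rewrite lexx andbT.
have := @segint_norm (fun u => P u c - P u d) a b (e * (w + h)) (- (k * h)) ab.
have cP : cont_on (fun u => P u c - P u d) a b.
  by apply: cont_onB; apply: closed_on_contP cl _.
have cQ : cont_on (fun v => Q b v - Q a v) c d.
  by apply: cont_onB; apply: closed_on_contQ cl _.
move=> /(_ cP) S1.
have := @segint_norm (fun v => Q b v - Q a v) c d (e * (w + h)) (k * w) cd.
move=> /(_ cQ) S2.
have {}S1 : `|segint (fun u => P u c - P u d) a b - - (k * h) * w| <=
    e * (w + h) * w.
  apply: S1 => u uI; have := Pn u c uI Ic; have := Pn u d uI Id.
  set A := `|_ - _ - _|; set B := `|_ - _ - _|.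
  move=> hA hB; apply: (@le_trans _ _ (A + B)).
    rewrite /A /B [_ + `|_|]addrC; apply: le_trans (ler_normB _ _).
    by rewrite le_eqVlt; apply/orP; left; apply/eqP; congr `|_|; rewrite /h; ring.
  by apply: (le_trans (lerD hA hB)); lra.
have {}S2 : `|segint (fun v => Q b v - Q a v) c d - (k * w) * h| <=
    e * (w + h) * h.
  apply: S2 => v vI; have := Qn a v Ia vI; have := Qn b v Ib vI.
  set A := `|_ - _ - _|; set B := `|_ - _ - _|.
  move=> hA hB; apply: (@le_trans _ _ (A + B)).
    rewrite /A /B; apply: le_trans (ler_normB _ _).
    by rewrite le_eqVlt; apply/orP; left; apply/eqP; congr `|_|; rewrite /w; ring.
  by apply: (le_trans (lerD hA hB)); lra.
rewrite /rectint; set I1 := segint _ _ _ in S1 *; set I2 := segint _ _ _ in S2 *.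
have -> : I1 + I2 = (I1 - - (k * h) * w) + (I2 - (k * w) * h) by ring.
apply: le_trans (ler_normD _ _) _; apply: le_trans (lerD S1 S2) _.
by rewrite expr2 -mulrDr -mulrA.
Qed.

(** Goursat's argument: a rectangle with nonzero integral is bad for some e, so it
    contains nested bad quarters shrinking to a point, against [not_bad_at]. *)
Theorem closed_form_rectint0 a b c d : a <= b -> c <= d -> closed_on a b c d ->
  rectint P Q a b c d = 0.
Proof.
move=> ab cd cl; apply/eqP/negPn/negP => n0.
pose S := ((b - a) + (d - c)) ^+ 2 + 1.
have S0 : 0 < S by rewrite ltr_wpDl// sqr_ge0.
pose e := `|rectint P Q a b c d| / S.
have e0 : 0 < e by rewrite divr_gt0// normr_gt0.
have bad0 : bad e a b c d.
  split=> //; rewrite /e mulrAC ltr_pdivrMr// ltr_pM2l ?normr_gt0// /S.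
  by rewrite ltrDl.
pose X := {s : R * R * R * R | let: (a', b', c', d') := s in
  bad e a' b' c' d' /\ (a <= a' /\ b' <= b /\ c <= c' /\ d' <= d)}.
pose rel (s t : X) := let: (a1, b1, c1, d1) := sval s in
  let: (a2, b2, c2, d2) := sval t in
  [/\ a1 <= a2 /\ b2 <= b1, c1 <= c2 /\ d2 <= d1,
     b2 - a2 = (b1 - a1) / 2 & d2 - c2 = (d1 - c1) / 2].
have in0 : bad e a b c d /\ (a <= a /\ b <= b /\ c <= c /\ d <= d) by rewrite !lexx.
have x0 : X by exact: (exist _ (a, b, c, d) in0).
have step (s : X) : {t : X | rel s t}.
  case: s => -[[[a1 b1] c1] d1] /= [bd [h1 [h2 [h3 h4]]]].
  apply/cid; have cl1 : closed_on a1 b1 c1 d1 by exact: closed_onS cl.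
  have [a2 [b2 [c2 [d2 [bd2 [k1 k2] [k3 k4] l1 l2]]]]] := bad_quarter cl1 bd.
  have bd2' : bad e a2 b2 c2 d2 /\ (a <= a2 /\ b2 <= b /\ c <= c2 /\ d2 <= d).
    split=> //; repeat split; lra.
  by exists (exist _ (a2, b2, c2, d2) bd2').
have [f [f0 fS]] := @dependent_choice X rel step x0.
pose A n := (sval (f n)).1.1.1; pose B n := (sval (f n)).1.1.2.
pose C n := (sval (f n)).1.2; pose D n := (sval (f n)).2.
have badn n : bad e (A n) (B n) (C n) (D n) /\
    (a <= A n /\ B n <= b /\ c <= C n /\ D n <= d).
  by rewrite /A /B /C /D; case: (f n) => -[[[a1 b1] c1] d1].
have stp n : [/\ A n <= A n.+1 /\ B n.+1 <= B n, C n <= C n.+1 /\ D n.+1 <= D n,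
     B n.+1 - A n.+1 = (B n - A n) / 2 & D n.+1 - C n.+1 = (D n - C n) / 2].
  rewrite /A /B /C /D; have := fS n; rewrite /rel.
  by case: (sval (f n)) => -[[? ?] ?] ?; case: (sval (f n.+1)) => -[[? ?] ?] ?.
pose W := (B 0 - A 0) + (D 0 - C 0).
have width n : (B n - A n) + (D n - C n) = W / 2 ^+ n.
  elim: n => [|n IH]; first by rewrite expr0 divr1.
  have [_ _ -> ->] := stp n; by rewrite -mulrDl IH exprSr invfM mulrA.
have nd (u : nat -> R) : (forall n, u n <= u n.+1) ->
    forall m n, (m <= n)%N -> u m <= u n.
  by move=> uS m n; apply: (iffLR (nondecreasing_seqP u)).
have ni (u : nat -> R) : (forall n, u n.+1 <= u n) ->
    forall m n, (m <= n)%N -> u n <= u m.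
  by move=> uS m n; apply: (iffLR (nonincreasing_seqP u)).
have nest (u v : nat -> R) : (forall n, u n <= u n.+1) -> (forall n, v n.+1 <= v n) ->
    (forall n, u n <= v n) -> exists x, forall n, u n <= x <= v n.
  move=> uS vS uv; have uvmn m n : u m <= v n.
    apply: (le_trans (nd u uS m (maxn m n) (leq_maxl _ _))).
    by rewrite (le_trans (uv _))// ni// leq_maxr.
  exists (sup [set u n | n in setT]) => n; apply/andP; split.
    by apply: ub_le_sup; [exists (v 0) => _ [m _ <-]|exists n].
  by apply: ge_sup => [|_ [m _ <-]//]; exists (u 0), 0.
have [x xI] : exists x, forall n, A n <= x <= B n.
  apply: nest => n; [by have [[]] := stp n|by have [[]] := stp n|].
  by have [[]] := badn n.
have [y yI] : exists y, forall n, C n <= y <= D n.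
  apply: nest => n; [by have [_ []] := stp n|by have [_ []] := stp n|].
  by have [[]] := badn n.
have xy : in_rect a b c d x y.
  have [_ [h1 [h2 [h3 h4]]]] := badn 0; have /andP[? ?] := xI 0; have /andP[? ?] := yI 0.
  by split; apply/andP; split; lra.
have [r r0 nb] := not_bad_at e0 (cl x y xy).
have [n Wn] : exists n, W / 2 ^+ n <= r.
  exists (Num.truncn (W / r)).+1; rewrite ler_pdivrMr ?exprn_gt0// mulrC -ler_pdivrMr//.
  apply: (@le_trans _ _ (Num.truncn (W / r)).+1%:R).
    exact/ltW/truncnS_gt.
  by rewrite -natrX ler_nat ltnW// ltn_expl.
have [bdn [h1 [h2 [h3 h4]]]] := badn n; have [u1 u2 _] := bdn; have wn := width n.
apply: (nb (A n) (B n) (C n) (D n)) bdn => //; [|lra|lra].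
by apply: closed_onS cl.
Qed.

End ClosedForm.
End Goursat.

(** * Real-valued norms and differentiability estimates *)

Section ComplexNorm.
Variable R : realType.
Local Notation C := R[i].
Implicit Types z w : C.

Lemma rnorm1 : rnorm (1 : C) = 1.
Proof. by apply: (@complexI R); rewrite rnormE normr1. Qed.

Lemma rnormM z w : rnorm (z * w) = rnorm z * rnorm w.
Proof. exact: rnormZ. Qed.

Lemma rnormN (V : normedModType C) (x : V) : rnorm (- x) = rnorm x.
Proof. by rewrite /rnorm normrN. Qed.

Lemma rdistC (V : normedModType C) (x y : V) : rnorm (x - y) = rnorm (y - x).
Proof. by rewrite /rnorm distrC. Qed.

Lemma ler_rnormB (V : normedModType C) (x y : V) : rnorm (x - y) <= rnorm x + rnorm y.
Proof. by rewrite (le_trans (ler_rnormD _ _))// rnormN. Qed.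

Lemma rnormV z : rnorm z^-1 = (rnorm z)^-1.
Proof. by apply: (@complexI R); rewrite fmorphV/= !rnormE normfV. Qed.

Lemma rnorm_eq0 (V : normedModType C) (x : V) : (rnorm x == 0) = (x == 0).
Proof. by apply/eqP/eqP => [/rnorm0_eq0//|->]; rewrite rnorm0. Qed.

Lemma rnorm_gt0 (V : normedModType C) (x : V) : (0 < rnorm x) = (x != 0).
Proof. by rewrite lt_def rnorm_ge0 andbT rnorm_eq0. Qed.

Lemma rnormR (a : R) : rnorm (a%:C : C) = `|a|.
Proof. by rewrite /rnorm normc_def/= expr0n/= addr0 sqrtr_sqr. Qed.

Lemma sqr_rnorm z : rnorm z ^+ 2 = complex.Re z ^+ 2 + complex.Im z ^+ 2.
Proof. by rewrite /rnorm normc_def/= sqr_sqrtr// addr_ge0 ?sqr_ge0. Qed.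

Lemma rnormJ z : rnorm z^* = rnorm z.
Proof. by rewrite /rnorm normcJ. Qed.

Lemma mulJ z : z^* * z = (rnorm z ^+ 2)%:C.
Proof. by rewrite rmorphXn/= rnormE mulrC -sqr_normc. Qed.

Lemma abs_Re_le z : `|complex.Re z| <= rnorm z.
Proof. by rewrite -lecR rnormE normc_ge_Re. Qed.

Lemma abs_Im_le z : `|complex.Im z| <= rnorm z.
Proof.
rewrite -(@ler_pXn2r _ 2) ?nnegrE ?rnorm_ge0// sqr_rnorm real_normK ?num_real//.
by rewrite lerDr sqr_ge0.
Qed.

Lemma rnorm_le_ReIm z : rnorm z <= `|complex.Re z| + `|complex.Im z|.
Proof.
rewrite -(@ler_pXn2r _ 2) ?nnegrE ?rnorm_ge0 ?addr_ge0// sqr_rnorm sqrrD.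
rewrite !real_normK ?num_real// lerD2r lerDl.
by rewrite mulrn_wge0// mulr_ge0.
Qed.

Lemma normc1_rnorm (V : normedModType C) (x : V) : (`|x| < 1) = (rnorm x < 1).
Proof. by rewrite -rnormE -(ltcR (rnorm x) 1). Qed.

Lemma norm_lt_rnorm (V : normedModType C) (x : V) (d : R) :
  (`|x| < d%:C) = (rnorm x < d).
Proof. by rewrite -rnormE ltcR. Qed.

Lemma posc_real (d : C) : 0 < d -> exists2 r : R, 0 < r & d = r%:C.
Proof.
move=> d0; have dr : d = (complex.Re d)%:C.
  by rewrite RRe_real// ger0_real// ltW.
by exists (complex.Re d) => //; rewrite -ltcR -dr.
Qed.

Lemma near_rnorm (V : normedModType C) (a : V) (P : V -> Prop) :
  (\forall x \near a, P x) <->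
  exists2 r : R, 0 < r & forall x, rnorm (x - a) < r -> P x.
Proof.
split=> [/nbhs_normP[d /= /posc_real[r r0 ->] dP]|[r r0 rP]].
  by exists r => // x xr; apply: dP; rewrite /= distrC norm_lt_rnorm.
apply/nbhs_normP; exists r%:C; first by rewrite /= ltcR.
by move=> x /=; rewrite distrC norm_lt_rnorm; exact: rP.
Qed.

Lemma continuous_rnormP (V W : normedModType C) (f : V -> W) (a : V) :
  {for a, continuous f} <-> forall e : R, 0 < e ->
  exists2 r : R, 0 < r & forall x, rnorm (x - a) < r -> rnorm (f x - f a) < e.
Proof.
split=> [/cvgrPdist_lt fa e e0|fe].
  have /fa/near_rnorm[r r0 rP] : 0 < e%:C by rewrite ltcR.
  by exists r => // x /rP; rewrite distrC norm_lt_rnorm.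
apply/cvgrPdist_lt => _ /posc_real[e e0 ->]; apply/near_rnorm.
have [r r0 rP] := fe e e0; exists r => // x /rP.
by rewrite distrC norm_lt_rnorm.
Qed.

Lemma diff_rnorm (V W : normedModType C) (f : V -> W) (a : V) :
  differentiable f a -> forall e : R, 0 < e -> exists2 r : R, 0 < r &
  forall x, rnorm (x - a) < r ->
    rnorm (f x - f a - 'd f a (x - a)) <= e * rnorm (x - a).
Proof.
move=> /diff_locallyP[_ /eqaddoP fo] e e0.
have /fo/near_rnorm[r r0 rP] : 0 < e%:C by rewrite ltcR.
exists r => // x xr; have := rP (x - a); rewrite subr0 => /(_ xr) /=.
by rewrite -[`|_|]rnormE -[`|x - a|]rnormE -rmorphM lecR !fctE /= opprD subrK addrA.
Qed.

Lemma rnorm_diff (V W : normedModType C) (f : V -> W) (a : V) (L : {linear V -> W}) :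
  continuous L -> (forall e : R, 0 < e -> exists2 r : R, 0 < r &
  forall x, rnorm (x - a) < r ->
    rnorm (f x - f a - L (x - a)) <= e * rnorm (x - a)) ->
  differentiable f a.
Proof.
move=> Lc fL.
have H : f \o shift a = cst (f a) + L +o_ (0 : V) id.
  apply/eqaddoP => _ /posc_real[e e0 ->]; apply/near_rnorm.
  have [r r0 rP] := fL e e0; exists r => // h; rewrite subr0 => hr.
  have := rP (h + a); rewrite addrK => /(_ hr).
  by rewrite -[`|_ h|]rnormE -[`|id h|]rnormE -rmorphM lecR !fctE /= opprD addrA.
by apply/diff_locallyP; rewrite (diff_unique Lc H).
Qed.

Lemma rnorm_diff1 (f : C -> C) (a c : C) :
  (forall e : R, 0 < e -> exists2 r : R, 0 < r &
  forall x, rnorm (x - a) < r ->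
    rnorm (f x - f a - (x - a) * c) <= e * rnorm (x - a)) ->
  differentiable f a.
Proof.
move=> fL; apply: (@rnorm_diff _ _ _ _ (c \*: (idfun : {linear C -> C}))).
  by move=> z; apply: differentiable_continuous; apply: differentiableZ.
move=> e /fL[r r0 rP]; exists r => // x /rP.
by rewrite [(x - a) * c]mulrC.
Qed.

Lemma diff1_rnorm (f : C -> C) (a : C) : differentiable f a ->
  exists c : C, forall e : R, 0 < e -> exists2 r : R, 0 < r &
  forall x, rnorm (x - a) < r ->
    rnorm (f x - f a - (x - a) * c) <= e * rnorm (x - a).
Proof.
move=> /diff_rnorm fd; exists ('d f a 1) => e /fd[r r0 rP]; exists r => // x /rP.
by rewrite -{1}[x - a]mulr1 linearZ.
Qed.

End ComplexNorm.

(** * Cauchy-Riemann equations and the complex exponential *)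

Section CircleMean.
Variable R : realType.
Local Notation C := R[i].

(** The Cauchy-Riemann equations, for the imaginary part of h(z) dz. *)
Lemma differentiable_closed_form (h : C -> C) (x0 y0 : R) :
  differentiable h (x0 +i* y0) ->
  closed_form_at (fun x y => complex.Im (h (x +i* y)))
                 (fun x y => complex.Re (h (x +i* y))) x0 y0.
Proof.
move=> /diff1_rnorm[[al be] hk]; exists be, al, (- be).
have key e : 0 < e -> exists2 r, 0 < r & forall x y,
    `|x - x0| <= r -> `|y - y0| <= r ->
    rnorm (h (x +i* y) - h (x0 +i* y0) - ((x - x0) +i* (y - y0)) * (al +i* be)) <=
      e * (`|x - x0| + `|y - y0|).
  move=> e0; have [r r0 rP] := hk e e0.
  exists (r / 3); first by rewrite divr_gt0.
  move=> x y xr yr; have le1 := rnorm_le_ReIm ((x - x0) +i* (y - y0)).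
  apply: le_trans (rP (x +i* y) _) _; first by apply: le_lt_trans le1 _ => /=; lra.
  by rewrite ler_pM2l.
split=> e /key[r r0 rP]; exists r => // x y xr yr;
  apply: le_trans (rP x y xr yr).
  apply: le_trans (abs_Im_le _); rewrite le_eqVlt; apply/orP; left.
  case: (h (x +i* y)) (h (x0 +i* y0)) => [a b] [a0 b0] /=.
  by apply/eqP; congr `|_|; ring.
apply: le_trans (abs_Re_le _); rewrite le_eqVlt; apply/orP; left.
case: (h (x +i* y)) (h (x0 +i* y0)) => [a b] [a0 b0] /=.
by apply/eqP; congr `|_|; ring.
Qed.

Definition cexp (w : C) : C :=
  (expR (complex.Re w) * cos (complex.Im w)) +i* (expR (complex.Re w) * sin (complex.Im w)).

Lemma cexpD z w : cexp (z + w) = cexp z * cexp w.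
Proof.
case: z w => [a b] [c d]; rewrite /cexp/= expRD cosD sinD.
by apply/eqP; rewrite eq_complex /=; apply/andP; split; apply/eqP; ring.
Qed.

Lemma rnorm_cexp w : rnorm (cexp w) = expR (complex.Re w).
Proof.
apply/eqP; rewrite -(@eqrXn2 _ 2) ?rnorm_ge0 ?expR_ge0// sqr_rnorm /=.
by rewrite !exprMn -mulrDr cos2Dsin2 mulr1.
Qed.

Lemma derive_rnorm (f : R -> R) (a d : R) : is_derive a 1 f d ->
  forall e, 0 < e -> exists2 r, 0 < r & forall x, `|x - a| < r ->
  `|f x - f a - (x - a) * d| <= e * `|x - a|.
Proof.
move=> [/derivable1_diffP dfa fd] e e0.
move: (dfa) => /diff_locallyP[_ /eqaddoP /(_ e e0) /nbhs_normP[r r0 rP]].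
have Z x : 'd f a (x - a) = (x - a) * d.
  rewrite -fd deriveE// -[(x - a) * _]/((x - a) *: 'd f a 1) -linearZ /=.
  by rewrite [_ *: _]mulr1.
exists r => // x xr; have := rP (x - a); rewrite /= sub0r normrN => /(_ xr).
by rewrite !fctE /= subrK opprD addrA Z.
Qed.

(** By [cexpD] it is enough to differentiate at 0, where the three real
    expansions of exp, sin and cos are combined. *)
Lemma differentiable_cexp w : differentiable cexp w.
Proof.
have d0 e : 0 < e -> exists2 r : R, 0 < r & forall h : C, rnorm h < r ->
    rnorm (cexp h - 1 - h) <= e * rnorm h.
  move=> e0; have [k [e8 k1 ke]] : exists k : R, [/\ 0 < k, k <= 1 & k <= e / 8].
    exists (Num.min (e / 8) 1); split; last by rewrite ge_min lexx.
      by rewrite lt_min ltr01 divr_gt0.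
    by rewrite ge_min lexx orbT.
  have [r1 r10 E] := derive_rnorm (is_derive_expR (0 : R)) e8.
  have [r2 r20 S] := derive_rnorm (is_derive_sin (0 : R)) e8.
  have [r3 r30 K] := derive_rnorm (is_derive_cos (0 : R)) e8.
  pose r := Num.min (Num.min r1 r2) (Num.min r3 (Num.min 1 (k))).
  exists r; first by rewrite /r !lt_min r10 r20 r30 ltr01 e8.
  case=> x y hr; have := hr; rewrite /r !lt_min.
  move=> /andP[/andP[h1 h2] /and3P[h3 h4 h5]].
  have xh : `|x| <= rnorm (x +i* y) by exact: (abs_Re_le (x +i* y)).
  have yh : `|y| <= rnorm (x +i* y) by exact: (abs_Im_le (x +i* y)).
  set n := rnorm (x +i* y) in h1 h2 h3 h4 h5 xh yh *.
  have n0 : 0 <= n by exact: rnorm_ge0.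
  have := E x; rewrite subr0 expR0 mulr1 => /(_ (le_lt_trans xh h1)) Ex.
  have := S y; rewrite subr0 sin0 cos0 mulr1 subr0 => /(_ (le_lt_trans yh h2)) Sy.
  have := K y; rewrite subr0 sin0 cos0 oppr0 mulr0 subr0 => /(_ (le_lt_trans yh h3)) Ky.
  have {}Ex : `|expR x - 1 - x| <= k * n.
    by apply: le_trans Ex _; rewrite ler_pM2l.
  have {}Sy : `|sin y - y| <= k * n by apply: le_trans Sy _; rewrite ler_pM2l.
  have {}Ky : `|cos y - 1| <= k * n by apply: le_trans Ky _; rewrite ler_pM2l.
  have n1 : k * n <= k by rewrite ler_piMr// ltW.
  have nn : n * n <= k * n by rewrite ler_wpM2r// ltW.
  have cy : `|cos y| <= 1 by rewrite ler_norml cos_geN1 cos_le1.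
  have x1 : `|1 + x| <= 2.
    by rewrite (le_trans (ler_normD _ _))// normr1; lra.
  have y1 : `|sin y| <= 1 by rewrite ler_norml sin_geN1 sin_le1.
  apply: le_trans (rnorm_le_ReIm _) _; rewrite /cexp /=.
  have -> : expR x * cos y - 1 - x = (expR x - 1 - x) * cos y + (1 + x) * (cos y - 1).
    by ring.
  have -> : expR x * sin y - 0 - y =
    (expR x - 1 - x) * sin y + x * sin y + (sin y - y) by ring.
  have T1 : `|(expR x - 1 - x) * cos y| <= k * n.
    by rewrite normrM -[leRHS]mulr1 ler_pM.
  have T2 : `|(1 + x) * (cos y - 1)| <= 2 * (k * n) by rewrite normrM ler_pM.
  have T3 : `|(expR x - 1 - x) * sin y| <= k * n.
    by rewrite normrM -[leRHS]mulr1 ler_pM.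
  have sy2 : `|sin y| <= 2 * n.
    have := ler_normD (sin y - y) y; rewrite subrK.
    have kn : k * n <= n by rewrite ler_piMl.
    lra.
  have T4 : `|x * sin y| <= 2 * (k * n).
    rewrite normrM (le_trans (ler_pM _ _ xh sy2))//; lra.
  have := ler_normD ((expR x - 1 - x) * cos y) ((1 + x) * (cos y - 1)).
  have := ler_normD ((expR x - 1 - x) * sin y + x * sin y) (sin y - y).
  have := ler_normD ((expR x - 1 - x) * sin y) (x * sin y).
  have kn : k * n <= e / 8 * n by rewrite ler_wpM2r.
  have en : 0 <= e * n by rewrite mulr_ge0// ltW.
  by lra.
apply: (@rnorm_diff1 _ _ _ (cexp w)) => e e0.
have [r r0 rP] := d0 (e / expR (complex.Re w)) (divr_gt0 e0 (expR_gt0 _)).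
exists r => // x /rP; have -> : cexp x - cexp w - (x - w) * cexp w =
    cexp w * (cexp (x - w) - 1 - (x - w)).
  have {1}-> : x = w + (x - w) by ring.
  by rewrite cexpD; ring.
rewrite rnormM rnorm_cexp => le1; apply: le_trans (ler_wpM2l (expR_ge0 _) le1) _.
by rewrite mulrA (mulrC (expR _)) divfK// gt_eqF// expR_gt0.
Qed.
End CircleMean.

(** * Maximum principle and Schwarz lemma *)

Section MaxPrinciple.
Variable R : realType.
Local Notation C := R[i].

(** In the coordinate w = log (z / s), the circles around 0 become vertical segments
    of length 2 pi and F becomes a 2 pi i-periodic differentiable function.  By
    Goursat its mean over a circle does not depend on the radius; it tends to
    F 0 = 0 for small radii, whereas the hypothesis makes it at most - e s^2 on
    the circle of radius s.  At the centre F is only continuous, which lets the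
    maximum principle below tolerate an isolated singular point. *)
Lemma no_peak (F : C -> C) (d e : R) : 0 < d -> 0 < e ->
  (forall z, 0 < rnorm z -> rnorm z < d -> differentiable F z) ->
  {for 0, continuous F} -> F 0 = 0 ->
  ~ (forall z, rnorm z < d -> complex.Re (F z) <= - e * rnorm z ^+ 2).
Proof.
move=> d0 e0 dF cF F0 Fe.
pose s := d / 2; have s0 : 0 < s by rewrite divr_gt0.
have sd : s < d by rewrite /s; lra.
pose h (w : C) := F (s%:C * cexp w).
have nh w : rnorm (s%:C * cexp w) = s * expR (complex.Re w).
  by rewrite rnormM rnormR rnorm_cexp gtr0_norm.
have dh w : complex.Re w <= 0 -> differentiable h w.
  move=> w0; apply: differentiable_comp.
    by apply: differentiableM; [exact: differentiable_cst|exact: differentiable_cexp].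
  apply: dF; rewrite nh; first by rewrite mulr_gt0// expR_gt0.
  rewrite (le_lt_trans _ sd)// -[leRHS]mulr1 ler_pM2l//.
  by rewrite -expR0 ler_expR.
pose P x y := complex.Im (h (x +i* y)); pose Q x y := complex.Re (h (x +i* y)).
pose eta := e * s ^+ 2 / 2.
have eta0 : 0 < eta by rewrite divr_gt0// mulr_gt0// exprn_gt0.
have [r r0 rP] := (iffLR (continuous_rnormP F 0)) cF eta eta0.
(* chosen so that the circle of radius s exp (- X) lies in the disc of radius r *)
pose X := `|ln (r / (2 * s))|; have X0 : 0 <= X by exact: normr_ge0.
have rX : s * expR (- X) < r.
  have : expR (- X) <= r / (2 * s).
    have r2 : r / (2 * s) \is Num.pos by rewrite posrE divr_gt0// mulr_gt0.
    rewrite -[leRHS](lnK r2) ler_expR /X.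
    by have := ler_norm (- ln (r / (2 * s))); rewrite normrN; lra.
  move=> /(ler_wpM2l (ltW s0)) le1; apply: (le_lt_trans le1).
  rewrite [_ * _](_ : _ = r / 2); first by rewrite ltr_pdivrMr// ltr_pMr// ltr1n.
  by field; rewrite gt_eqF.
have cl : closed_on P Q (- X) 0 0 (2 * pi).
  move=> x y [/andP[_ x0] _]; apply: differentiable_closed_form; exact: dh.
have pi0 : 0 < 2 * pi :> R by rewrite mulr_gt0// pi_gt0.
have per x : cexp (x +i* (2 * pi)) = cexp (x +i* 0).
  by rewrite /cexp /= mulr_natl cos2pi sin2pi cos0 sin0.
have := closed_form_rectint0 _ (ltW pi0) cl; rewrite oppr_le0 => /(_ X0).
rewrite /rectint; have -> : (fun x => P x 0 - P x (2 * pi)) = fun=> 0.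
  by apply/funext => x; rewrite /P /h per subrr.
rewrite segint_cst ?oppr_le0// mul0r add0r => I0.
have : segint (fun y => Q 0 y - Q (- X) y) 0 (2 * pi) <= - eta * (2 * pi - 0).
  apply: segint_le => [||y _]; first exact: ltW.
    apply: cont_onB; apply: (closed_on_contQ cl).
      by rewrite lexx andbT oppr_le0.
    by rewrite lexx oppr_le0.
  have Q0 : Q 0 y <= - e * s ^+ 2.
    have := Fe (s%:C * cexp (0 +i* y)); rewrite nh /= expR0 mulr1; exact.
  have QX : - Q (- X) y <= eta.
    have := rP (s%:C * cexp (- X +i* y)).
    rewrite subr0 nh F0 subr0 => /(_ rX) /ltW; apply: le_trans.
    by rewrite (le_trans (ler_norm _))// normrN /Q /h abs_Re_le.
  by rewrite /eta in QX *; lra.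
by rewrite I0 subr0 leNgt mulNr oppr_lt0 mulr_gt0.
Qed.
End MaxPrinciple.

Section Schwarz.
Variable R : realType.
Local Notation C := R[i].

Lemma rnorm_continuous (V : normedModType C) : continuous (@rnorm R V).
Proof.
move=> x; apply/cvgrPdist_lt => e e0; apply/near_rnorm; exists e => // y yx.
rewrite (le_lt_trans _ yx)// rdistC ler_distl; apply/andP; split.
  by have := ler_rnormD (y - x) x; rewrite subrK (rdistC y); lra.
by have := ler_rnormD (x - y) y; rewrite subrK; lra.
Qed.

Lemma compact_disc (r : R) : compact [set z : C | rnorm z <= r].
Proof.
pose f (p : R * R) : C := p.1 +i* p.2.
have cf : continuous f.
  move=> p; apply/cvgrPdist_lt => _ /posc_real[e e0 ->].
  have e2 : 0 < e / 2 by rewrite divr_gt0.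
  near=> q; rewrite norm_lt_rnorm; apply: le_lt_trans (rnorm_le_ReIm _) _.
  rewrite /f/=; have h1 : `|p.1 - q.1| < e / 2.
    by near: q; apply: cvgr_dist_lt => //; exact: cvg_fst.
  have h2 : `|p.2 - q.2| < e / 2.
    by near: q; apply: cvgr_dist_lt => //; exact: cvg_snd.
  lra.
have := @compact_setX _ _ `[- r, r]%classic `[- r, r]%classic
  (@segment_compact _ _ _) (@segment_compact _ _ _).
move=> /(continuous_compact (continuous_subspaceT cf)) cB.
apply: (subclosed_compact _ cB).
  apply: (@closed_comp _ _ (@rnorm R C) [set x | x <= r]); last exact: closed_le.
  by move=> z _; exact: rnorm_continuous.
move=> z /= zr; exists (complex.Re z, complex.Im z); last by case: z {zr}.
by split; rewrite /= in_itv/= -ler_norml; apply: le_trans zr; 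
  [exact: abs_Re_le|exact: abs_Im_le].
Unshelve. all: by end_near. Qed.

Lemma sqr_rnormD (u v : C) :
  rnorm (u + v) ^+ 2 = rnorm u ^+ 2 + 2 * complex.Re (u^* * v) + rnorm v ^+ 2.
Proof. by rewrite !sqr_rnorm; case: u v => [a b] [c d] /=; ring. Qed.

(** If |w a| > M, then |w z|^2 + e |z|^2 for small e attains its maximum over the
    closed disc at an interior point c.  Expanding |w (c + z)|^2 around w c shows
    that F z = 2 conj (w c) (w (c + z) - w c) + 2 e conj c z contradicts
    [no_peak].  The point 0, where w is only continuous, is the removable
    singularity met in [schwarz]. *)
Lemma max_principle (w : C -> C) (r M : R) : 0 < r ->
  (forall z, rnorm z <= r -> {for z, continuous w}) ->
  (forall z, 0 < rnorm z -> rnorm z < r -> differentiable w z) ->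
  (forall z, rnorm z = r -> rnorm (w z) <= M) ->
  forall z, rnorm z <= r -> rnorm (w z) <= M.
Proof.
move=> r0 cw dw wM a ar; rewrite leNgt; apply/negP => Ma.
have M0 : 0 <= M by apply: le_trans (wM r%:C _); rewrite ?rnorm_ge0// rnormR gtr0_norm.
have gap : 0 < rnorm (w a) ^+ 2 - M ^+ 2.
  by rewrite subr_gt0 ltrXn2r// rnorm_ge0.
pose e := (rnorm (w a) ^+ 2 - M ^+ 2) / (2 * r ^+ 2).
have e0 : 0 < e by rewrite divr_gt0// mulr_gt0// exprn_gt0.
have er : e * r ^+ 2 < rnorm (w a) ^+ 2 - M ^+ 2.
  rewrite /e [_ * _](_ : _ = (rnorm (w a) ^+ 2 - M ^+ 2) / 2); last first.
    by field; rewrite gt_eqF.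
  by rewrite ltr_pdivrMr// ltr_pMr// ltr1n.
pose G z := rnorm (w z) ^+ 2 + e * rnorm z ^+ 2.
have cG : {in [set z : C | rnorm z <= r], continuous G}.
  have -> : G = fun z => rnorm (w z) * rnorm (w z) + e * (rnorm z * rnorm z).
    by apply/funext => z; rewrite /G !expr2.
  move=> z; rewrite inE => zr.
  have c1 : {for z, continuous (fun z => rnorm (w z))}.
    by apply: continuous_comp; [exact: cw|exact: rnorm_continuous].
  have c2 : {for z, continuous (@rnorm R C)} by exact: rnorm_continuous.
  exact: (cvgD (cvgM c1 c1) (cvgM (cvg_cst e) (cvgM c2 c2))).
have [c cr Gc] := compact_EVT_max (ex_intro _ a ar) (@compact_disc r)
  (continuous_in_subspaceT cG).
rewrite inE/= in cr.
have Gmax z : rnorm z <= r -> G z <= G c by move=> zr; apply: Gc; rewrite inE.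
have Gca : rnorm (w a) ^+ 2 <= G c.
  by apply: le_trans (Gmax a ar); rewrite lerDl mulr_ge0 ?sqr_ge0// ltW.
have {}cr : rnorm c < r.
  rewrite lt_neqAle cr andbT; apply/eqP => cr'; move: Gca; rewrite /G cr'.
  have := wM c cr'; rewrite -(@ler_pXn2r _ 2) ?nnegrE ?rnorm_ge0//; lra.
pose d := if c == 0 then r else Num.min (r - rnorm c) (rnorm c).
have d0 : 0 < d.
  by rewrite /d; case: eqVneq => // c0; rewrite lt_min subr_gt0 cr rnorm_gt0.
have dcz z : rnorm z < d -> rnorm (c + z) < r.
  rewrite /d; case: eqVneq => [->|c0]; first by rewrite add0r.
  rewrite lt_min => /andP[zr _]; apply: le_lt_trans (ler_rnormD _ _) _; lra.
have dn0 z : 0 < rnorm z -> rnorm z < d -> 0 < rnorm (c + z).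
  rewrite /d; case: eqVneq => [->|c0]; first by rewrite add0r.
  move=> z0; rewrite lt_min => /andP[_ zc].
  by have := ler_rnormB (c + z) z; rewrite addrK; lra.
pose F z := 2%:R * (w c)^* * (w (c + z) - w c) + (2 * e)%:C * c^* * z.
apply: (@no_peak R F d e d0 e0).
- move=> z z0 zd; apply: differentiableD; last by apply: differentiableM.
  apply: differentiableM; first exact: differentiable_cst.
  apply: differentiableB; last exact: differentiable_cst.
  apply: differentiable_comp; first exact: differentiableD.
  by apply: dw; [exact: dn0|exact: dcz].
- have cwc : {for 0, continuous (fun z => w (c + z))}.
    apply: (@continuous_comp _ _ _ (fun z => c + z) w).
      by apply: differentiable_continuous; exact: differentiableD.
    by rewrite addr0; apply: cw; exact: ltW.
  have c1 : {for 0, continuous (fun z => 2%:R * (w c)^* * (w (c + z) - w c))}.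
    exact: (cvgM (cvg_cst _) (cvgB cwc (cvg_cst _))).
  have c2 : {for 0, continuous (fun z => (2 * e)%:C * c^* * z)}.
    by apply: differentiable_continuous; exact: differentiableM.
  exact: (cvgD c1 c2).
- by rewrite /F addr0 subrr !mulr0 addr0.
- have aux (p q u v : C) : complex.Re (2%:R * p^* * q + (2 * e)%:C * u^* * v) =
      2 * complex.Re (p^* * q) + 2 * e * complex.Re (u^* * v).
    by case: p q u v => [? ?] [? ?] [? ?] [? ?] /=; ring.
  move=> z zd; have := Gmax (c + z) (ltW (dcz z zd)); rewrite /G.
  have -> : rnorm (w (c + z)) ^+ 2 = rnorm (w c) ^+ 2 +
      2 * complex.Re ((w c)^* * (w (c + z) - w c)) + rnorm (w (c + z) - w c) ^+ 2.
    by rewrite -sqr_rnormD [w c + _]addrC subrK.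
  rewrite (sqr_rnormD c z).
  have := sqr_ge0 (rnorm (w (c + z) - w c)).
  have -> : complex.Re (F z) = 2 * complex.Re ((w c)^* * (w (c + z) - w c)) +
      2 * e * complex.Re (c^* * z).
    exact: aux.
  lra.
Qed.

Lemma near_eq_differentiable1 (f g : C -> C) z :
  (\forall x \near z, f x = g x) -> differentiable f z -> differentiable g z.
Proof.
move=> /near_rnorm[r1 r10 fg] /diff1_rnorm[c fc].
apply: (rnorm_diff1 (c := c)) => e /fc[r2 r20 rP].
exists (Num.min r1 r2); first by rewrite lt_min r10.
move=> x; rewrite lt_min => /andP[x1 x2].
by rewrite -!fg// ?subrr ?rnorm0//; exact: rP.
Qed.

(** The maximum principle for k z / z, extended by the derivative of k at 0. *)
Lemma schwarz (k : C -> C) : (forall z, rnorm z < 1 -> differentiable k z) ->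
  (forall z, rnorm z < 1 -> rnorm (k z) <= 1) -> k 0 = 0 ->
  forall z, rnorm z < 1 -> rnorm (k z) <= rnorm z.
Proof.
move=> dk k1 k0 a a1; have [->|a0] := eqVneq a 0; first by rewrite k0 rnorm0.
have [|c kc] := diff1_rnorm (dk 0 _); first by rewrite rnorm0.
pose w z := if z == 0 then c else k z / z.
have wE z : z != 0 -> w z = k z / z by rewrite /w => /negbTE ->.
have dw z : 0 < rnorm z -> rnorm z < 1 -> differentiable w z.
  rewrite rnorm_gt0 => z0 z1.
  have : differentiable (fun z => k z / z) z.
    by apply: differentiableM; [exact: dk|exact: differentiableV].
  apply: near_eq_differentiable1; apply/near_rnorm; exists (rnorm z).
    by rewrite rnorm_gt0.
  move=> x xz; rewrite wE//; apply: contraTneq xz => ->.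
  by rewrite sub0r rnormN ltxx.
have cw z : rnorm z < 1 -> {for z, continuous w}.
  have [-> _|z0 z1] := eqVneq z 0; last first.
    by apply: differentiable_continuous; apply: dw => //; rewrite rnorm_gt0.
  apply/continuous_rnormP => e e0.
  have e2 : 0 < e / 2 by rewrite divr_gt0.
  have [r r0 rP] := kc _ e2; exists r => // x xr.
  rewrite {2}/w eqxx; have [->|x0] := eqVneq x 0; first by rewrite /w eqxx subrr rnorm0.
  have := rP x xr; rewrite !subr0 k0 subr0 wE//.
  have -> : k x / x - c = (k x - x * c) / x by field.
  rewrite rnormM rnormV -ler_pdivrMr ?rnorm_gt0// => /le_lt_trans; apply.
  by rewrite ltr_pdivrMr// ltr_pMr// ltr1n.
have key (r : R) : rnorm a < r -> r < 1 -> rnorm (k a) <= rnorm a / r.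
  move=> ar r1; have r0 : 0 < r by exact: le_lt_trans (rnorm_ge0 _) ar.
  have := @max_principle w r r^-1 r0 _ _ _ a (ltW ar).
  rewrite wE// rnormM rnormV ler_pdivrMr ?rnorm_gt0// mulrC; apply.
  - by move=> z zr; apply: cw; exact: le_lt_trans zr _.
  - by move=> z z0 zr; apply: dw => //; exact: lt_trans zr _.
  - move=> z zr; rewrite wE -?rnorm_gt0 ?zr// rnormM rnormV zr ler_piMl ?invr_ge0 ?(ltW r0)//.
    by apply: k1; rewrite zr.
rewrite leNgt; apply/negP => ka.
pose n := rnorm a; have n0 : 0 < n by rewrite rnorm_gt0.
have k0' : 0 < rnorm (k a) by exact: lt_trans ka.
pose q := n / rnorm (k a).
have q1 : q < 1 by rewrite /q ltr_pdivrMr// mul1r.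
pose r := Num.max ((1 + n) / 2) ((1 + q) / 2).
have nr : n < r by rewrite lt_max; apply/orP; left; rewrite -/n in a1; lra.
have r1 : r < 1 by rewrite gt_max; apply/andP; split; rewrite -/n in a1; lra.
have qr : q < r by rewrite lt_max; apply/orP; right; lra.
have := key r nr r1; have r0 : 0 < r by exact: lt_trans nr.
rewrite ler_pdivlMr// leNgt => /negP; apply.
by rewrite mulrC -ltr_pdivrMr.
Qed.

End Schwarz.

(** * Schwarz-Pick estimates on the disc and the polydisc *)

Section SchwarzPick.
Variable R : realType.
Local Notation C := R[i].

(** The largest Euclidean distance between two points of the disc at
    pseudo-hyperbolic distance r, reached by two opposite points. *)
Definition gap (r : R) : R := 2 * r / (1 + Num.sqrt (1 - r ^+ 2)).

Lemma gap_den r : 0 < 1 + Num.sqrt (1 - r ^+ 2) :> R.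
Proof. by rewrite ltr_wpDr ?sqrtr_ge0. Qed.

Lemma gap_ge0 r : 0 <= r -> 0 <= gap r.
Proof. by move=> r0; rewrite divr_ge0 ?mulr_ge0// ltW// gap_den. Qed.

Lemma gap_le2 r : 0 <= r -> gap r <= 2 * r.
Proof.
move=> r0; rewrite ler_pdivrMr ?gap_den//.
by rewrite ler_peMr ?mulr_ge0// lerDl sqrtr_ge0.
Qed.

Lemma gap1 : gap 1 = 2.
Proof. by rewrite /gap expr1n subrr sqrtr0 addr0 mulr1 divr1. Qed.

Lemma mobius_id (p q : C) : rnorm (1 - p^* * q) ^+ 2 =
  rnorm (p - q) ^+ 2 + (1 - rnorm p ^+ 2) * (1 - rnorm q ^+ 2).
Proof. by rewrite !sqr_rnorm; case: p q => [a b] [c d] /=; ring. Qed.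

Lemma mobius_den (p q : C) : rnorm p < 1 -> rnorm q < 1 -> 1 - p^* * q != 0.
Proof.
move=> p1 q1; rewrite subr_eq0; apply/eqP => pq.
have : rnorm (p^* * q) < 1.
  rewrite rnormM rnormJ; have := rnorm_ge0 p; have := rnorm_ge0 q; nra.
by rewrite -pq rnorm1 ltxx.
Qed.

Lemma ph_dist_lt1 (p q : C) : rnorm p < 1 -> rnorm q < 1 -> ph_dist p q < 1.
Proof.
move=> p1 q1; have D0 := mobius_den p1 q1.
rewrite /ph_dist rnormM rnormV ltr_pdivrMr ?rnorm_gt0// mul1r.
rewrite -(@ltr_pXn2r _ 2) ?nnegrE ?rnorm_ge0// mobius_id ltrDl.
by rewrite mulr_gt0// subr_gt0 expr_lt1// rnorm_ge0.
Qed.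

Lemma ph_dist_ge0 (p q : C) : 0 <= ph_dist p q.
Proof. exact: rnorm_ge0. Qed.

(** With d = |p - q|, the identity [mobius_id] and the bound
    (1 - |p|^2)(1 - |q|^2) <= (1 - d^2 / 4)^2 give d <= r (1 + d^2 / 4): d does not
    lie strictly between the roots of this quadratic inequality, and d < 2 puts it
    below the smaller one, which is [gap r]. *)
Lemma ph_dist_gap (p q : C) (r : R) : rnorm p < 1 -> rnorm q < 1 ->
  r <= 1 -> ph_dist p q <= r -> rnorm (p - q) <= gap r.
Proof.
move=> p1 q1 r1 pqr; have r0 : 0 <= r := le_trans (ph_dist_ge0 _ _) pqr.
have D0 := mobius_den p1 q1.
move: pqr; rewrite /ph_dist rnormM rnormV ler_pdivrMr ?rnorm_gt0// => pqr.
have := mobius_id p q; have x0 := rnorm_ge0 p; have y0 := rnorm_ge0 q.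
have dxy : rnorm (p - q) <= rnorm p + rnorm q by exact: ler_rnormB.
have d0 := rnorm_ge0 (p - q); have E0 := rnorm_ge0 (1 - p^* * q).
rewrite /gap ler_pdivlMr ?gap_den//.
have r2 : 0 <= 1 - r ^+ 2 by rewrite subr_ge0 expr_le1.
have := sqr_sqrtr r2; have := sqrtr_ge0 (1 - r ^+ 2).
move: (Num.sqrt (1 - r ^+ 2)) => s s0 s2.
move: (rnorm (1 - p^* * q)) (rnorm (p - q)) (rnorm p) (rnorm q) p1 q1 pqr x0 y0 dxy d0 E0 =>
  E d x y x1 y1 dE x0 y0 dxy d0 E0 id.
have le1 : (1 - x ^+ 2) * (1 - y ^+ 2) <= (1 - d ^+ 2 / 4) ^+ 2.
  have xx : x ^+ 2 <= 1 by rewrite expr_le1// ltW.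
  have yy : y ^+ 2 <= 1 by rewrite expr_le1// ltW.
  have h : (1 - x ^+ 2) * (1 - y ^+ 2) <= (1 - (x ^+ 2 + y ^+ 2) / 2) ^+ 2.
    rewrite -subr_ge0 [leRHS](_ : _ = ((x ^+ 2 - y ^+ 2) / 2) ^+ 2) ?sqr_ge0//.
    by field.
  have d2 : d ^+ 2 <= (x + y) ^+ 2 by rewrite ler_pXn2r ?nnegrE ?addr_ge0.
  have xy := sqr_ge0 (x - y).
  have k1 : 0 <= 1 - (x ^+ 2 + y ^+ 2) / 2 by lra.
  have k2 : 1 - (x ^+ 2 + y ^+ 2) / 2 <= 1 - d ^+ 2 / 4 by lra.
  by apply: le_trans h _; rewrite ler_pXn2r ?nnegrE// (le_trans k1).
have le2 : d <= r * (1 + d ^+ 2 / 4).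
  have q0 : 0 <= 1 + d ^+ 2 / 4 by rewrite addr_ge0// divr_ge0// sqr_ge0.
  have EE : E <= 1 + d ^+ 2 / 4.
    rewrite -(@ler_pXn2r _ 2) ?nnegrE// id.
    rewrite -(lerD2l (d ^+ 2)) in le1; apply: le_trans le1 _.
    by rewrite le_eqVlt; apply/orP; left; apply/eqP; field.
  exact: le_trans dE (ler_wpM2l r0 EE).
have [r0'|rn0] := eqVneq r 0.
  move: le2; rewrite r0' mul0r => le2; have -> : d = 0 by lra.
  by rewrite mul0r mulr0.
have rp : 0 < r by rewrite lt_neqAle eq_sym rn0.
have f2 : r * d < 2 * (1 + s) by nra.
have f1 : r * d <= 2 * (1 - s).
  rewrite leNgt; apply/negP => f1.
  have : (r * d - 2 * (1 - s)) * (r * d - 2 * (1 + s)) < 0.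
    by rewrite pmulr_rlt0 ?subr_gt0// subr_lt0.
  have -> : (r * d - 2 * (1 - s)) * (r * d - 2 * (1 + s)) =
      r * (4 * (r * (1 + d ^+ 2 / 4) - d)) + 4 * (1 - r ^+ 2 - s ^+ 2) by field.
  rewrite s2 subrr mulr0 addr0 ltNge => /negP; apply.
  by rewrite mulr_ge0// mulr_ge0// subr_ge0.
rewrite -(ler_pM2l rp).
have -> : r * (2 * r) = 2 * (1 - s) * (1 + s).
  have -> : r * (2 * r) = 2 * (1 - (1 - r ^+ 2)) by ring.
  by rewrite -s2; ring.
by rewrite mulrA ler_wpM2r// addr_ge0.
Qed.

(** Schwarz's lemma for (h 0 - h z) / (1 - conj (h 0) h z), then [ph_dist_gap].  The
    values of h may have modulus 1, so the argument is run for s h with s < 1 close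
    enough to 1. *)
Lemma schwarz_pick (h : C -> C) : (forall z, rnorm z < 1 -> differentiable h z) ->
  (forall z, rnorm z < 1 -> rnorm (h z) <= 1) ->
  forall z, rnorm z < 1 -> rnorm (h 0 - h z) <= gap (rnorm z).
Proof.
have strict (g : C -> C) : (forall z, rnorm z < 1 -> differentiable g z) ->
    (forall z, rnorm z < 1 -> rnorm (g z) < 1) ->
    forall z, rnorm z < 1 -> rnorm (g 0 - g z) <= gap (rnorm z).
  move=> dg g1 z z1; have n0 : rnorm (0 : C) < 1 by rewrite rnorm0.
  apply: ph_dist_gap; [exact: g1|exact: g1|exact: ltW|].
  apply: (@schwarz R (fun z => (g 0 - g z) / (1 - (g 0)^* * g z)) _ _ _ _ z1).
  - move=> x x1; apply: differentiableM.
      by apply: differentiableB; [exact: differentiable_cst|exact: dg].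
    apply: differentiableV; last by apply: mobius_den; exact: g1.
    apply: differentiableB; first exact: differentiable_cst.
    by apply: differentiableM; [exact: differentiable_cst|exact: dg].
  - by move=> x x1; apply/ltW/ph_dist_lt1; exact: g1.
  - by rewrite subrr mul0r.
move=> dh h1 z z1; rewrite leNgt; apply/negP => hz.
have g0 := gap_ge0 (rnorm_ge0 z).
set d := rnorm (h 0 - h z) in hz; have d0 : 0 < d by exact: le_lt_trans g0 hz.
pose q := gap (rnorm z) / d; have q0 : 0 <= q by rewrite divr_ge0// ltW.
have q1 : q < 1 by rewrite ltr_pdivrMr// mul1r.
pose s := (1 + q) / 2; have s1 : s < 1 by rewrite /s; lra.
have s0 : 0 < s by rewrite /s; lra.
have : rnorm (s%:C * h 0 - s%:C * h z) <= gap (rnorm z).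
  apply: (strict (fun z => s%:C * h z) _ _ _ z1) => [x x1|x x1].
    by apply: differentiableM; [exact: differentiable_cst|exact: dh].
  rewrite rnormM rnormR (gtr0_norm s0); have := h1 x x1.
  have := rnorm_ge0 (h x); nra.
rewrite -mulrBr rnormM rnormR (gtr0_norm s0) -/d leNgt => /negP; apply.
by rewrite -ltr_pdivrMr// -/q /s; lra.
Qed.

End SchwarzPick.

Section PolydiscGap.
Variables (R : realType) (n : nat).
Local Notation C := R[i].
Local Notation Cn := 'rV[R[i]]_n.

Lemma polydiscP (z : Cn) : polydisc z <-> forall j, rnorm (z ord0 j) < 1.
Proof. by split=> zP j; have := zP j; rewrite normc1_rnorm. Qed.

Lemma differentiable_row (g : 'I_n -> C -> C) (x : C) :
  (forall j, differentiable (g j) x) ->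
  differentiable (fun z => \row_j g j z : Cn) x.
Proof.
move=> dg; have -> : (fun z => \row_j g j z : Cn) =
    \sum_(j < n) (fun z => g j z *: (delta_mx ord0 j : Cn)).
  apply/funext => z; rewrite fct_sumE; apply/rowP => k.
  rewrite summxE (bigD1 k)//= big1 ?addr0; first by rewrite !mxE !eqxx mulr1.
  by move=> j jk; rewrite !mxE eqxx eq_sym (negbTE jk) mulr0.
by apply: differentiable_sum => j; exact: differentiableZl.
Qed.

(** The analytic disc with coordinates z |-> (a_j - t_j z) / (1 - conj (a_j) t_j z)
    goes through a at 0; the choice of t_j, of modulus at most 1 since
    beta (a_j, b_j) <= r, makes it go through b at r. *)
Lemma polydisc_gap (f : Cn -> C) (a b : Cn) (r : R) :
  holomorphic_on_polydisc f -> (forall z, polydisc z -> rnorm (f z) <= 1) ->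
  polydisc a -> polydisc b -> 0 <= r -> r <= 1 ->
  (forall j, ph_dist (a ord0 j) (b ord0 j) <= r) ->
  rnorm (f a - f b) <= gap r.
Proof.
move=> df f1 Da Db r0; rewrite le_eqVlt => /predU1P[->|r1] abr.
  by rewrite gap1 (le_trans (ler_rnormB _ _))//; have := f1 a Da; have := f1 b Db; lra.
have /polydiscP a1 := Da; have /polydiscP b1 := Db.
have [r0'|rn0] := eqVneq r 0.
  suff -> : a = b by rewrite subrr rnorm0 gap_ge0.
  apply/rowP => j; apply/eqP; rewrite -subr_eq0 -rnorm_eq0.
  have := abr j; rewrite r0' /ph_dist rnormM rnormV => h.
  have := mobius_den (a1 j) (b1 j); rewrite -rnorm_gt0 => D0.
  by move: h; rewrite ler_pdivrMr// mul0r eq_le rnorm_ge0 andbT.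
have rp : 0 < r by rewrite lt_neqAle eq_sym rn0.
pose m j := (a ord0 j - b ord0 j) / (1 - (a ord0 j)^* * b ord0 j).
pose t j := m j / r%:C.
have t1 j : rnorm (t j) <= 1.
  by rewrite /t rnormM rnormV rnormR gtr0_norm// ler_pdivrMr// mul1r; exact: abr.
have tz j z : rnorm z < 1 -> rnorm (t j * z) < 1.
  move=> z1; rewrite rnormM; have := t1 j; have := rnorm_ge0 (t j).
  by have := rnorm_ge0 z; nra.
pose g j z := (a ord0 j - t j * z) / (1 - (a ord0 j)^* * (t j * z)).
pose gam z : Cn := \row_j g j z.
have gD z : rnorm z < 1 -> polydisc (gam z).
  by move=> z1; apply/polydiscP => j; rewrite mxE; exact: ph_dist_lt1 (tz j z z1).
have g0 : gam 0 = a.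
  by apply/rowP => j; rewrite mxE /g !mulr0 !subr0 divr1.
have gr : gam r%:C = b.
  apply/rowP => j; rewrite mxE /g /t divfK; last by rewrite -rnorm_gt0 rnormR normr_gt0.
  rewrite /m; have := mobius_den (a1 j) (b1 j).
  have := mobius_den (a1 j) (a1 j).
  move: (a ord0 j) (b ord0 j) => p q h1 h2; field.
  by rewrite h2 [X in X != 0](_ : _ = 1 - p^* * p)//; ring.
have : rnorm ((f \o gam) 0 - (f \o gam) r%:C) <= gap (rnorm (r%:C : C)).
  apply: schwarz_pick => [z z1|z z1|]; last by rewrite rnormR gtr0_norm.
    apply: differentiable_comp; last by apply: df; exact: gD.
    apply: differentiable_row => j; apply: differentiableM.
      by apply: differentiableB; [exact: differentiable_cst|exact: differentiableM].
    apply: differentiableV; last by apply: mobius_den; [exact: a1|exact: tz].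
    apply: differentiableB; first exact: differentiable_cst.
    by apply: differentiableM; [exact: differentiable_cst|exact: differentiableM].
  by apply: f1; exact: gD.
by rewrite /= g0 gr rnormR (gtr0_norm rp).
Qed.

End PolydiscGap.

(** * Montel's theorem on the polydisc *)

Section Ultra.

Lemma ultra_fmap (T U : Type) (f : T -> U) (F : set_system T) :
  UltraFilter F -> UltraFilter (f @ F).
Proof.
move=> UF; split => [|H PH FH]; first exact: fmap_proper_filter.
apply/seteqP; split=> // A HA; rewrite /fmap/=.
have [//|nA] := in_ultra_setVsetC (f @^-1` A) UF.
have /filterI/(_ HA) : H (~` A) by exact: FH.
by rewrite setICl => /filter_not_empty.
Qed.

End Ultra.

Section Slices.
Variables (R : realType) (n : nat).
Local Notation C := R[i].
Local Notation Cn := 'rV[R[i]]_n.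

Lemma rnorm_coord (z : Cn) j : rnorm (z ord0 j) <= rnorm z.
Proof.
rewrite -lecR !rnormE; suff : `|z ord0 j| <= mx_norm z by [].
rewrite mx_normE -[leLHS]nngE num_le.
exact: (le_bigmax _ (fun i => `|z i.1 i.2|%:nng) (ord0, j)).
Qed.

Lemma rnorm_row_lt (z : Cn) (d : R) : 0 < d ->
  (forall j, rnorm (z ord0 j) < d) -> rnorm z < d.
Proof.
move=> d0 zd; rewrite -norm_lt_rnorm; have [->|z0] := eqVneq z 0.
  by rewrite normr0 ltcR.
have /mx_norm_neq0[[i j] /= nz] : mx_norm z != 0.
  by apply: contra_neq z0; exact: mx_norm_eq0.
by rewrite (_ : `|z| = mx_norm z)// nz ord1 norm_lt_rnorm.
Qed.

Lemma polydisc_rnorm (z : Cn) : polydisc z <-> rnorm z < 1.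
Proof.
split=> [/polydiscP|z1]; first exact: rnorm_row_lt.
by apply/polydiscP => j; exact: le_lt_trans (rnorm_coord z j) z1.
Qed.

Lemma compact_polydisc (r : R) : compact [set z : Cn | rnorm z <= r].
Proof.
have := @rV_compact C n (fun=> [set z : C | rnorm z <= r]) (fun=> @compact_disc R r).
move=> cB; apply: (subclosed_compact _ cB).
  apply: (@closed_comp _ _ (@rnorm R Cn) [set x | x <= r]); last exact: closed_le.
  by move=> z _; exact: rnorm_continuous.
by move=> z /= zr j; exact: le_trans (rnorm_coord z j) zr.
Qed.

(** Schwarz's lemma on the complex line through a and a + h. *)
Lemma slice_schwarz (F : Cn -> C) (a h : Cn) (s m : R) :
  0 < s -> 0 < m -> holomorphic_on_polydisc F ->
  (forall z, rnorm (z - a) < s -> polydisc z) ->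
  (forall z, rnorm (z - a) < s -> rnorm (F z) <= m) ->
  rnorm h < s -> rnorm (F (a + h) - F a) <= 2 * m / s * rnorm h.
Proof.
move=> s0 m0 dF sD Fm hs; have [->|h0] := eqVneq h 0.
  by rewrite addr0 subrr !rnorm0 mulr0.
have hp : 0 < rnorm h by rewrite rnorm_gt0.
pose c := s / rnorm h; have c0 : 0 < c by rewrite divr_gt0.
pose k (z : C) := (F (a + (z * c%:C) *: h) - F a) / (2 * m)%:C.
have m2 : 0 < 2 * m by rewrite mulr_gt0.
have n2 : rnorm ((2 * m)%:C : C) = 2 * m by rewrite rnormR gtr0_norm.
have zs (z : C) : rnorm z < 1 -> rnorm (a + (z * c%:C) *: h - a) < s.
  move=> z1; rewrite addrC addKr rnormZ rnormM rnormR (gtr0_norm c0) -mulrA.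
  by rewrite /c divfK ?gt_eqF// gtr_pMl.
have aa : rnorm (a - a) < s by rewrite subrr rnorm0.
have kz : rnorm (k (rnorm h / s)%:C) <= rnorm ((rnorm h / s)%:C : C).
  apply: schwarz; rewrite /k.
  - move=> z z1; apply: differentiableM; last exact: differentiable_cst.
    apply: differentiableB; last exact: differentiable_cst.
    apply: differentiable_comp; last by apply: dF; apply: sD; exact: zs.
    apply: differentiableD; first exact: differentiable_cst.
    by apply: differentiableZl; exact: differentiableM.
  - move=> z z1; rewrite rnormM rnormV n2 ler_pdivrMr// mul1r.
    apply: le_trans (ler_rnormB _ _) _.
    by rewrite mulr_natl mulr2n lerD// Fm// zs.
  - by rewrite mul0r scale0r addr0 subrr mul0r.
  - by rewrite rnormR gtr0_norm ?divr_gt0// ltr_pdivrMr// mul1r.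
move: kz; rewrite /k -rmorphM /c mulrA divfK ?gt_eqF// divff ?gt_eqF// scale1r.
rewrite rnormM rnormV n2 rnormR (gtr0_norm (divr_gt0 hp s0)) ler_pdivrMr//.
by move=> le1; apply: le_trans le1 _; rewrite mulrC !mulrA mulrAC.
Qed.

(** [slice_schwarz] along t v, with t tending to 0. *)
Lemma slice_schwarz_diff (F : Cn -> C) (a v : Cn) (s m : R) :
  0 < s -> 0 < m -> holomorphic_on_polydisc F ->
  (forall z, rnorm (z - a) < s -> polydisc z) ->
  (forall z, rnorm (z - a) < s -> rnorm (F z) <= m) ->
  rnorm ('d F a v) <= 2 * m / s * rnorm v.
Proof.
move=> s0 m0 dF sD Fm; have [->|v0] := eqVneq v 0.
  by rewrite linear0 !rnorm0 mulr0.
have vp : 0 < rnorm v by rewrite rnorm_gt0.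
have da : differentiable F a by apply/dF/sD; rewrite subrr rnorm0.
apply/ler_addgt0Pr => e e0.
have [r r0 rP] := diff_rnorm da (divr_gt0 e0 vp).
pose q := Num.min r s; have q0 : 0 < q by rewrite lt_min r0.
pose t := q / (2 * rnorm v); have t0 : 0 < t by rewrite divr_gt0// mulr_gt0.
have tv : rnorm (t%:C *: v) = q / 2.
  by rewrite rnormZ rnormR gtr0_norm// /t; field; rewrite gt_eqF.
have q2 : q / 2 < q by rewrite ltr_pdivrMr// ltr_pMr// ltr1n.
have h1 : rnorm (a + t%:C *: v - a) < r.
  by rewrite addrC addKr tv (lt_le_trans q2)// ge_min lexx.
have h2 : rnorm (t%:C *: v) < s by rewrite tv (lt_le_trans q2)// ge_min lexx orbT.
have := rP _ h1; have := slice_schwarz s0 m0 dF sD Fm h2.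
rewrite [a + _ - a]addrC addKr linearZ /= rnormZ rnormR (gtr0_norm t0).
set A := F _ - F a; move=> k1 k2.
have : rnorm (t%:C *: 'd F a v) <= 2 * m / s * (t * rnorm v) + e / rnorm v * (t * rnorm v).
  have -> : t%:C *: 'd F a v = A - (A - t%:C *: 'd F a v) by rewrite opprB addrC subrK.
  by apply: le_trans (ler_rnormB _ _) _; exact: lerD.
rewrite rnormZ rnormR (gtr0_norm t0).
have -> : 2 * m / s * (t * rnorm v) + e / rnorm v * (t * rnorm v) =
    t * (2 * m / s * rnorm v + e) by field; rewrite !gt_eqF.
by rewrite ler_pM2l.
Qed.

End Slices.

Section Montel.
Variables (R : realType) (n : nat).
Local Notation C := R[i].
Local Notation Cn := 'rV[R[i]]_n.
Local Notation HI := (Hinf R n).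

Lemma Hinf_rnorm (f : HI) : rnorm f = Hinf_norm f.
Proof. by []. Qed.

Lemma Hinf_ball (f : HI) : `|f| <= 1 <-> forall z, rnorm (f z) <= 1.
Proof.
rewrite -rnormE Hinf_rnorm lecR; split=> [f1 z|f1].
  exact: le_trans (Hinf_norm_ub _ _) f1.
by apply: Hinf_norm_le => z _; exact: f1.
Qed.

Lemma Hinf_holo (f : HI) : holomorphic_on_polydisc f.
Proof. by case: (HinfP f). Qed.

Lemma Hinf_out (f : HI) z : ~ polydisc z -> f z = 0.
Proof. by case: (HinfP f) => _ _; apply. Qed.

Lemma HinfB (f g : HI) z : (f - g) z = f z - g z.
Proof. by []. Qed.

Lemma cvg_rnormP (T : Type) (V : normedModType C) (G : set_system T) (u : T -> V) (l : V) :
  Filter G -> (u @ G --> l <->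
  forall e : R, 0 < e -> G [set t | rnorm (u t - l) < e]).
Proof.
move=> FG; split=> [/cvgrPdist_lt ul e e0|ul].
  have /ul : 0 < e%:C by rewrite ltcR.
  by apply: filterS => t /=; rewrite distrC norm_lt_rnorm.
apply/cvgrPdist_lt => _ /posc_real[e e0 ->].
by apply: filterS (ul e e0) => t /=; rewrite distrC norm_lt_rnorm.
Qed.

Lemma cvg_rnorm_le (T : Type) (V : normedModType C) (G : set_system T) (u : T -> V) (l : V)
    (k : R) : ProperFilter G -> u @ G --> l ->
  G [set t | rnorm (u t) <= k] -> rnorm l <= k.
Proof.
move=> FG /cvg_rnormP ul uk; apply/ler_addgt0Pr => e e0.
have [t [/= h1 h2]] := filter_ex (filterI uk (ul e e0)).
have -> : l = u t - (u t - l) by rewrite opprB addrC subrK.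
by apply: le_trans (ler_rnormB _ _) _; rewrite lerD// ltW.
Qed.

Lemma ultra_lim (T : Type) (G : set_system T) (u : T -> C) (k : R) :
  UltraFilter G -> G [set t | rnorm (u t) <= k] ->
  exists2 l : C, u @ G --> l & rnorm l <= k.
Proof.
move=> UG uk; have := @compact_disc R k; rewrite compact_ultra.
move=> /(_ _ (ultra_fmap u UG) uk)[l [lk ul]].
by exists l.
Qed.

Section UltraLimit.
Variables (G : set_system HI) (UG : UltraFilter G).
Hypothesis Gball : G [set f : HI | forall z, rnorm (f z) <= 1].
Variable l : Cn -> C.
Hypothesis Gl : forall z, (fun f : HI => f z) @ G --> l z.

Lemma inner_ball (a : Cn) : polydisc a -> exists s : R,
  [/\ 0 < s, s < 1 & forall z, rnorm (z - a) < s -> rnorm z <= 1 - s].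
Proof.
move=> /polydisc_rnorm a1; exists ((1 - rnorm a) / 3).
have a0 := rnorm_ge0 a; split; [lra|lra|] => z za.
by have := ler_rnormD (z - a) a; rewrite subrK; lra.
Qed.

(** The unit ball of bounded holomorphic functions is locally equi-Lipschitz by
    [slice_schwarz], so pointwise convergence is uniform on a compact polydisc. *)
Lemma ultra_locally_uniform (r e : R) : r < 1 -> 0 < e ->
  G [set f : HI | forall z, rnorm z <= r -> rnorm (f z - l z) <= e].
Proof.
move=> r1 e0; have FG : Filter G by apply: filter_filter.
have /compact_near_coveringP cov := @compact_polydisc R n r.
apply: (cov HI G (fun f z => rnorm (f z - l z) <= e) FG) => x /= xr.
have Dx : polydisc x by apply/polydisc_rnorm; exact: le_lt_trans xr r1.
have [s [s0 s1 sx]] := inner_ball Dx.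
pose q := Num.min s (e * s / 8).
have q0 : 0 < q by rewrite lt_min s0 divr_gt0// mulr_gt0.
have lip (f : HI) h : (forall z, rnorm (f z) <= 1) -> rnorm h < q ->
    rnorm (f (x + h) - f x) <= e / 4.
  move=> f1; rewrite lt_min => /andP[hs he].
  apply: le_trans (slice_schwarz s0 ltr01 (@Hinf_holo f) _ _ hs) _ => //.
    move=> z /sx zs; apply/polydisc_rnorm; apply: le_lt_trans zs _; lra.
  rewrite mulr1 mulrAC ler_pdivrMr//; lra.
have lipl h : rnorm h < q -> rnorm (l (x + h) - l x) <= e / 4.
  move=> hq; apply: (cvg_rnorm_le (u := fun f : HI => f (x + h) - f x) (G := G)).
    by apply: cvgB; exact: Gl.
  by apply: filterS Gball => f f1; exact: lip.
have e2 : 0 < e / 2 by rewrite divr_gt0.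
have nx : \forall x' \near (x : Cn), rnorm (x' - x) < q.
  by apply/near_rnorm; exists q.
exists ([set x' | rnorm (x' - x) < q],
  [set f : HI | (forall z, rnorm (f z) <= 1) /\ rnorm (f x - l x) < e / 2]).
  split; first exact: nx.
  apply: filterI Gball _; exact: (iffLR (cvg_rnormP _ _ _)).
move=> [x' f] /= [x'q [f1 fx]].
have xE : x' = x + (x' - x) by rewrite addrC subrK.
have := lip f _ f1 x'q; have := lipl _ x'q; rewrite -xE => k1 k2.
have -> : f x' - l x' = (f x' - f x) + (f x - l x) - (l x' - l x) by ring.
apply: le_trans (ler_rnormB _ _) _; have := ler_rnormD (f x' - f x) (f x - l x).
lra.
Qed.

(** The differentials converge along G to a bounded linear map L.  For f close to l
    near a, [slice_schwarz] and [slice_schwarz_diff] applied to the differences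
    f - f', with f' tending to l, bound the increment of f - l and the difference
    of differentials by a small multiple of |h|; the differentiability of this
    single f gives the rest. *)
Lemma ultra_differentiable (a : Cn) : polydisc a -> differentiable l a.
Proof.
move=> Da; have [s [s0 s1 sa]] := inner_ball Da.
have saD z : rnorm (z - a) < s -> polydisc z.
  move=> /sa zs; apply/polydisc_rnorm; apply: le_lt_trans zs _; lra.
have PG : ProperFilter G := @ultra_proper _ _ UG.
have limd v : exists d : C, (fun f : HI => 'd f a v : C) @ G --> d.
  have ub : G [set f : HI | rnorm ('d f a v : C) <= 2 * 1 / s * rnorm v].
    apply: filterS Gball => f f1.
    exact: (@slice_schwarz_diff R n f a v s 1 s0 ltr01 (@Hinf_holo f) saD (fun z _ => f1 z)).
  by have [d dP _] := ultra_lim UG ub; exists d.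
have [D DP] := choice limd.
have Dlin : linear D.
  move=> k v w; apply: (@cvg_unique _ (@norm_hausdorff _ C) ((fun f : HI => 'd f a (k *: v + w) : C) @ G)).
    exact: DP.
  have -> : (fun f : HI => 'd f a (k *: v + w) : C) =
      (fun f : HI => k *: ('d f a v : C) + 'd f a w).
    by apply/funext => f; rewrite linearP.
  by apply: cvgD; [apply: cvgZr; exact: DP|exact: DP].
pose L : {linear Cn -> C} := HB.pack D (GRing.isLinear.Build _ _ _ _ D Dlin).
have LE v : L v = D v by [].
have Lb v : rnorm (L v) <= 2 * 1 / s * rnorm v.
  rewrite LE; apply: (cvg_rnorm_le PG (DP v)); apply: filterS Gball => f f1.
  exact: (@slice_schwarz_diff R n f a v s 1 s0 ltr01 (@Hinf_holo f) saD (fun z _ => f1 z)).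
have Lc : continuous L.
  move=> v; apply/continuous_rnormP => e e0; exists (e * s / 2).
    by rewrite divr_gt0// mulr_gt0.
  move=> w wv; rewrite -linearB; apply: le_lt_trans (Lb _) _.
  by rewrite mulr1 mulrAC ltr_pdivrMr//; lra.
apply: (rnorm_diff Lc) => e e0.
pose m := e * s / 32; have m0 : 0 < m by rewrite divr_gt0// mulr_gt0.
have s1' : 1 - s < 1 by lra.
have Gm := ultra_locally_uniform s1' m0.
have [f fm] := filter_ex Gm.
have m20 : 0 < 2 * m by rewrite mulr_gt0.
have ff' : G [set f' : HI | forall z, rnorm (z - a) < s -> rnorm ((f - f' : HI) z) <= 2 * m].
  apply: filterS Gm => f' f'm z /sa zs; rewrite HinfB.
  have -> : f z - f' z = (f z - l z) - (f' z - l z) by ring.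
  apply: le_trans (ler_rnormB _ _) _; have := fm z zs; have := f'm z zs; lra.
have e2 : 0 < e / 2 by rewrite divr_gt0.
have [r r0 rP] := diff_rnorm (@Hinf_holo f a Da) e2.
exists (Num.min r s); first by rewrite lt_min r0.
move=> x; rewrite lt_min => /andP[xr xs].
pose h := x - a; have xE : x = a + h by rewrite /h addrC subrK.
have K1 : rnorm ((f x - l x) - (f a - l a)) <= 2 * (2 * m) / s * rnorm h.
  apply: (cvg_rnorm_le (u := fun f' : HI => (f x - f' x) - (f a - f' a)) (G := G)).
    by apply: cvgB; apply: cvgB; [exact: cvg_cst|exact: Gl|exact: cvg_cst|exact: Gl].
  apply: filterS ff' => f' f'm.
  suff: rnorm ((f - f' : HI) (a + h) - (f - f' : HI) a) <= 2 * (2 * m) / s * rnorm h.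
    by rewrite -xE.
  exact: (@slice_schwarz R n (f - f') a h s (2 * m) s0 m20 (@Hinf_holo (f - f')) saD f'm xs).
have K2 : rnorm ('d f a h - L h) <= 2 * (2 * m) / s * rnorm h.
  apply: (cvg_rnorm_le (u := fun f' : HI => 'd f a h - 'd f' a h) (G := G)).
    by rewrite LE; apply: cvgB; [exact: cvg_cst|exact: DP].
  apply: filterS ff' => f' f'm.
  pose F : Cn -> C := (Hinf_val f - Hinf_val f')%R.
  have dF : holomorphic_on_polydisc F.
    by move=> z Dz; exact: (differentiableB (@Hinf_holo f z Dz) (@Hinf_holo f' z Dz)).
  have := @slice_schwarz_diff R n F a h s (2 * m) s0 m20 dF saD f'm.
  have E : 'd F a h = 'd f a h - 'd f' a h.
    exact: (congr1 (fun u => u h) (diffB (@Hinf_holo f a Da) (@Hinf_holo f' a Da))).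
  by rewrite [X in rnorm X]E.
have -> : l x - l a - L (x - a) = (f x - f a - 'd f a (x - a)) -
  ((f x - l x) - (f a - l a)) + ('d f a h - L h) by rewrite -/h; ring.
have K0 := rP x xr; rewrite -/h in K0 *.
have mE : 2 * (2 * m) / s * rnorm h = e / 8 * rnorm h.
  by rewrite /m; field; rewrite gt_eqF.
rewrite mE in K1 K2; apply: le_trans (ler_rnormD _ _) _.
set A := (f x - f a - _) in K0 *; set B := (_ - (f a - l a)) in K1 *.
have := ler_rnormB A B; have h0 : 0 <= e * rnorm h by rewrite mulr_ge0 ?rnorm_ge0// ltW.
lra.
Qed.

Lemma ultra_Hinf : exists2 g : HI, forall z, g z = l z & `|g| <= 1.
Proof.
have PG : ProperFilter G := @ultra_proper _ _ UG.
have l1 z : rnorm (l z) <= 1.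
  by apply: (cvg_rnorm_le (u := fun f : HI => f z) PG); [exact: Gl|]; apply: filterS Gball => f; exact.
have lH : l \in @Hinf_pred R n.
  apply/asboolP; split; [exact: ultra_differentiable|by exists 1|].
  move=> z Dz; apply: rnorm0_eq0; apply/eqP; rewrite eq_le rnorm_ge0 andbT.
  apply: (cvg_rnorm_le (u := fun f : HI => f z) PG); [exact: Gl|]; apply: filterS Gball => f _ /=.
  by rewrite Hinf_out// rnorm0.
by exists (MkHinf lH) => //; apply/Hinf_ball.
Qed.

End UltraLimit.

(** The unit ball is compact for locally uniform convergence, in terms of
    ultrafilters. *)
Lemma montel (G : set_system HI) : UltraFilter G -> G [set f : HI | `|f| <= 1] ->
  exists2 g : HI, `|g| <= 1 & forall r e : R, r < 1 -> 0 < e ->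
    G [set f : HI | forall z, rnorm z <= r -> rnorm (f z - g z) <= e].
Proof.
move=> UG Gb.
have Gball : G [set f : HI | forall z, rnorm (f z) <= 1].
  by apply: filterS Gb => f /Hinf_ball.
have lim1 z : exists x : C, (fun f : HI => f z) @ G --> x.
  have ub : G [set f : HI | rnorm (f z) <= 1] by apply: filterS Gball => f; exact.
  by have [x xP _] := ultra_lim UG ub; exists x.
have [l Gl] := choice lim1.
have [g gl g1] := ultra_Hinf UG Gball Gl.
exists g => // r e r1 e0; apply: filterS (ultra_locally_uniform UG Gball Gl r1 e0).
by move=> f fl z zr; rewrite gl; exact: fl.
Qed.

(** An operator that only sees f on a smaller polydisc turns the locally uniform
    convergence of [montel] into convergence in norm.  An ultrafilter on the image
    of the ball is lifted to the ball by a section S of T. *)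
Lemma compact_op_interior (T : HI -> HI) (r : R) : r < 1 ->
  (forall (f g : HI) (e : R), 0 < e -> (forall z, rnorm z <= r -> rnorm (f z - g z) <= e) ->
    rnorm (T f - T g) <= 2 * e) ->
  compact_op T.
Proof.
move=> r1 Tr; rewrite /compact_op.
suff cT : compact (T @` [set f : HI | `|f| <= 1]).
  rewrite precompact_closed//; apply: compact_closed cT.
  exact: (@norm_hausdorff _ (Hinf R n)).
rewrite compact_ultra => F UF FT.
have pre y : exists f : HI, (T @` [set f : HI | `|f| <= 1]) y -> `|f| <= 1 /\ T f = y.
  have [[f f1 fy]|nT] := pselect ((T @` [set f : HI | `|f| <= 1]) y); first by exists f.
  by exists 0.
have [S SP] := choice pre.
have UG := ultra_fmap S UF.
have SB : F (S @^-1` [set f : HI | `|f| <= 1]).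
  by apply: filterS FT => y Ty; have [] := SP y Ty.
have [g g1 gP] := montel UG SB.
exists (T g); split; first by exists g.
suff : (fun y : HI => y) @ F --> T g by [].
apply/cvg_rnormP => e e0; have e4 : 0 < e / 4 by rewrite divr_gt0.
have H : F (S @^-1` [set f : HI | forall z, rnorm z <= r -> rnorm (f z - g z) <= e / 4]).
  exact: gP.
apply: (filterS _ (filterI FT H)) => y [Ty h].
have [_ yE] := SP y Ty; rewrite -yE; apply: le_lt_trans (Tr _ _ _ e4 h) _; lra.
Qed.

End Montel.

(** * The upper bound *)

Section LimitFacts.
Variables (R : realType) (n : nat) (phi psi : polydisc_selfmap R n).
Local Notation C := R[i].
Local Notation Cn := 'rV[R[i]]_n.
Local Notation sd := (sup_dist phi psi).

Lemma ph_dist_le_max z j :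
  ph_dist (phi z ord0 j) (psi z ord0 j) <= max_dist phi psi z.
Proof. exact: (le_bigmax _ (fun j => ph_dist (phi z ord0 j) (psi z ord0 j))). Qed.

Lemma has_ub_max_dist d : has_ubound [set max_dist phi psi z | z in Edelta phi psi d].
Proof. by exists 1 => _ [z [j _ [Dz _]] <-]; exact: max_dist_le1. Qed.

Lemma max_dist_sup d z : Edelta phi psi d z -> max_dist phi psi z <= sd d.
Proof. by move=> Ez; apply: ub_le_sup; [exact: has_ub_max_dist|exists z]. Qed.

Lemma sup_dist_ge0 d : 0 <= sd d.
Proof.
have [E0|/set0P[z Ez]] := eqVneq (Edelta phi psi d) set0.
  by rewrite /sup_dist E0 image_set0 sup0.
exact: le_trans (max_dist_ge0 _ _ z) (max_dist_sup Ez).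
Qed.

Lemma sup_dist_le1 d : sd d <= 1.
Proof.
have [E0|/set0P[z Ez]] := eqVneq (Edelta phi psi d) set0.
  by rewrite /sup_dist E0 image_set0 sup0.
apply: ge_sup; first by exists (max_dist phi psi z), z.
by move=> _ [w [j _ [Dw _]] <-]; exact: max_dist_le1.
Qed.

Lemma sup_dist_le d1 d2 : d1 <= d2 -> sd d1 <= sd d2.
Proof.
move=> d12; have [E0|/set0P[z Ez]] := eqVneq (Edelta phi psi d1) set0.
  by rewrite {1}/sup_dist E0 image_set0 sup0 sup_dist_ge0.
apply: ge_sup; first by exists (max_dist phi psi z), z.
move=> _ [w [j _ [Dw dw]] <-]; apply: max_dist_sup; exists j => //; split=> //.
by rewrite (le_lt_trans _ dw)// lerB.
Qed.

Lemma cvg_sup_dist : sd d @[d --> 0^'+] --> lim_dist phi psi.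
Proof. exact: is_cvg_sup_dist. Qed.

Lemma lim_dist_le d : 0 < d -> lim_dist phi psi <= sd d.
Proof.
move=> d0; apply: limr_le; first exact: is_cvg_sup_dist.
near=> x; apply: sup_dist_le; apply: ltW; near: x.
exact: nbhs_right_lt.
Unshelve. all: by end_near. Qed.

Lemma lim_dist_ge0 : 0 <= lim_dist phi psi.
Proof.
apply: limr_ge; first exact: is_cvg_sup_dist.
by near=> x; exact: sup_dist_ge0.
Unshelve. all: by end_near. Qed.

Lemma lim_dist_le1 : lim_dist phi psi <= 1.
Proof. exact: le_trans (lim_dist_le ltr01) (sup_dist_le1 1). Qed.

End LimitFacts.

Section UpperBound.
Variables (R : realType) (n : nat).
Local Notation C := R[i].
Local Notation Cn := 'rV[R[i]]_n.
Local Notation HI := (Hinf R n).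

Lemma comp_opE (phi : polydisc_selfmap R n) (f : HI) z :
  polydisc z -> comp_op phi f z = f (phi z).
Proof. by move=> Dz; rewrite /= /comp_fun /patch mem_set. Qed.

Section Dilate.
Variables (phi : polydisc_selfmap R n) (r : R) (r0 : 0 <= r) (r1 : r <= 1).

Fact dilate_polydisc z : polydisc z -> polydisc (r%:C *: phi z).
Proof.
move=> /selfmap_polydisc Dz; apply/polydisc_rnorm; have /polydisc_rnorm := Dz phi.
by apply: le_lt_trans; rewrite rnormZ rnormR ger0_norm// ler_piMl// rnorm_ge0.
Qed.

Fact dilate_holo : holomorphic_on_polydisc (fun z => r%:C *: phi z).
Proof. by move=> z Dz; apply: differentiableZ; exact: selfmap_holo. Qed.

Definition dilate := PolydiscSelfmap dilate_polydisc dilate_holo.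

End Dilate.

Lemma dilate_move (f : HI) (a : Cn) (d r : R) : 0 < d -> 0 <= r -> r <= 1 ->
  1 - r <= d -> (forall z, rnorm (f z) <= 1) ->
  (forall j, rnorm (a ord0 j) <= 1 - d) ->
  rnorm (f a - f (r%:C *: a)) <= 2 * ((1 - r) / d).
Proof.
move=> d0 r0 r1 rd f1 ad.
have q0 : 0 <= (1 - r) / d by rewrite divr_ge0 ?subr_ge0// ltW.
apply: le_trans (gap_le2 q0).
have Da : polydisc a.
  by apply/polydiscP => j; apply: le_lt_trans (ad j) _; lra.
apply: polydisc_gap => //.
- exact: Hinf_holo.
- apply/polydisc_rnorm; rewrite rnormZ rnormR ger0_norm//.
  by apply: le_lt_trans (iffLR (polydisc_rnorm a) Da); rewrite ler_piMl// rnorm_ge0.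
- by rewrite ler_pdivrMr// mul1r.
move=> j; rewrite mxE; have := ad j; move: (a ord0 j) => p pd.
rewrite /ph_dist rnormM rnormV; apply: ler_pM; rewrite ?invr_ge0 ?rnorm_ge0//.
  have -> : p - r%:C * p = (1 - r)%:C * p by rewrite rmorphB rmorph1; ring.
  by rewrite rnormM rnormR ger0_norm ?subr_ge0// ler_piMr ?subr_ge0//; lra.
have h : d <= rnorm (1 - p^* * (r%:C * p)).
  have := ler_rnormD (1 - p^* * (r%:C * p) : C) (p^* * (r%:C * p)).
  rewrite subrK rnorm1 [rnorm (p^* * _)]rnormM rnormJ rnormM rnormR ger0_norm//.
  have p0 := rnorm_ge0 p; have p1 : rnorm p <= 1 by lra.
  have : rnorm p * (r * rnorm p) <= rnorm p by rewrite ler_piMr// mulr_ile1.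
  lra.
by rewrite lef_pV2 ?posrE// (lt_le_trans d0).
Qed.

Variables (phi psi : polydisc_selfmap R n).
Local Notation sd := (sup_dist phi psi).

(** The compact operator is C_(r phi) - C_(r psi), with r so close to 1 that
    [dilate_move] costs at most e / 2 for each of phi and psi off E_d.  On E_d,
    [polydisc_gap] is used for f and for w |-> f (r w). *)
Lemma ess_norm_le (d e : R) : 0 < d -> d < 1 -> 0 < e ->
  (ess_norm (comp_op phi \- comp_op psi)%R <= (2 * gap (sd d) + e)%:E)%E.
Proof.
move=> d0 d1 e0; pose q := Num.min (Num.min (1 / 2) d) (e * d / 4).
have q0 : 0 < q by rewrite !lt_min d0 !divr_gt0// mulr_gt0.
have q2 : q <= 1 / 2 by rewrite !ge_min lexx.
have qd : q <= d by rewrite !ge_min lexx orbT.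
have qe : q <= e * d / 4 by rewrite ge_min lexx orbT.
pose r := 1 - q; have r1 : r < 1 by rewrite /r; lra.
have r0 : 0 <= r by rewrite /r; lra.
pose K := (comp_op (dilate phi r0 (ltW r1)) \- comp_op (dilate psi r0 (ltW r1)))%R :
  {linear HI -> HI}.
have cK : compact_op K.
  apply: (@compact_op_interior _ _ _ r r1) => f g m m0 fg.
  apply: Hinf_norm_le => z Dz; rewrite !HinfB !comp_opE//=.
  have rz (w : Cn) : polydisc w -> rnorm (r%:C *: w) <= r.
    move=> /polydisc_rnorm w1; rewrite rnormZ rnormR ger0_norm//.
    by rewrite ler_piMr// ltW.
  set a := r%:C *: phi z; set b := r%:C *: psi z.
  have -> : f a - f b - (g a - g b) = (f a - g a) - (f b - g b) by ring.
  apply: le_trans (ler_rnormB _ _) _; rewrite mulr_natl mulr2n lerD// fg// rz//;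
    exact: selfmap_polydisc.
apply: le_trans; first by apply: ereal_inf_lbound; exists K.
apply: ge_ereal_sup => _ /= [f /Hinf_ball f1 <-]; rewrite lee_fin.
apply: Hinf_norm_le => z Dz.
rewrite -[X in rnorm X]/((comp_op phi f - comp_op psi f) z - K f z).
rewrite !HinfB !comp_opE//=; set a := phi z; set b := psi z.
have Da : polydisc a by exact: selfmap_polydisc.
have Db : polydisc b by exact: selfmap_polydisc.
have [Ez|nEz] := pselect (Edelta phi psi d z).
  have s0 := sup_dist_ge0 phi psi d; have s1 := sup_dist_le1 phi psi d.
  have ab j : ph_dist (a ord0 j) (b ord0 j) <= sd d.
    by apply: le_trans (ph_dist_le_max phi psi z j) _; exact: max_dist_sup.
  have k1 : rnorm (f a - f b) <= gap (sd d).
    by apply: polydisc_gap => //; exact: Hinf_holo.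
  have k2 : rnorm (f (r%:C *: a) - f (r%:C *: b)) <= gap (sd d).
    apply: (@polydisc_gap _ _ (fun z => f (r%:C *: z))) => // w Dw.
    apply: differentiable_comp; first exact: differentiableZ.
    apply: Hinf_holo; apply/polydisc_rnorm; rewrite rnormZ rnormR ger0_norm//.
    have /polydisc_rnorm := Dw; apply: le_lt_trans.
    by rewrite ler_piMl ?rnorm_ge0// ltW.
  by apply: le_trans (ler_rnormB _ _) _; lra.
have nE j : rnorm (a ord0 j) <= 1 - d /\ rnorm (b ord0 j) <= 1 - d.
  have [h|h] := leP (Num.max (rnorm (a ord0 j)) (rnorm (b ord0 j))) (1 - d).
    by move: h; rewrite ge_max => /andP[].
  by exfalso; apply: nEz; exists j.
have qr : 1 - r = q by rewrite /r; ring.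
have := @dilate_move f a d r d0 r0 (ltW r1) _ f1 (fun j => (nE j).1).
have := @dilate_move f b d r d0 r0 (ltW r1) _ f1 (fun j => (nE j).2).
rewrite qr => /(_ qd) k1 /(_ qd) k2.
have qde : q / d <= e / 4 by rewrite ler_pdivrMr// mulrAC.
have g0 := gap_ge0 (sup_dist_ge0 phi psi d).
have -> : f a - f b - (f (r%:C *: a) - f (r%:C *: b)) =
  (f a - f (r%:C *: a)) - (f b - f (r%:C *: b)) by ring.
apply: le_trans (ler_rnormB _ _) _; lra.
Qed.

Lemma gap_continuous (x : R) : {for x, continuous (@gap R)}.
Proof.
have c1 : {for x, continuous (fun r : R => 2 * r)}.
  exact: (cvgM (cvg_cst _) (@cvg_id _ _)).
have c2 : {for x, continuous (fun r : R => 1 - r ^+ 2)}.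
  apply: cvgB; first exact: cvg_cst.
  exact: exprn_continuous.
have c3 : {for x, continuous (fun r : R => Num.sqrt (1 - r ^+ 2))}.
  apply: (@continuous_comp _ _ _ (fun r : R => 1 - r ^+ 2) Num.sqrt) => //.
  exact: sqrt_continuous.
apply: (cvgM c1); apply: cvgV; first by rewrite gt_eqF// gap_den.
exact: (cvgD (cvg_cst _) c3).
Qed.

Lemma gapE (x : R) : 0 <= x <= 1 ->
  2 * gap x = (4 - 4 * Num.sqrt (1 - x ^+ 2)) / x.
Proof.
move=> /andP[x0 x1]; have [->|xn0] := eqVneq x 0.
  by rewrite invr0 mulr0 /gap mulr0 mul0r mulr0.
have h : 0 <= 1 - x ^+ 2 by rewrite subr_ge0 expr_le1.
have := gap_den x; have := sqr_sqrtr h; rewrite /gap.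
move: (Num.sqrt (1 - x ^+ 2)) => s s2 s0.
apply: (@mulIf _ (x * (1 + s))); first by rewrite mulf_neq0// gt_eqF.
have -> : 2 * (2 * x / (1 + s)) * (x * (1 + s)) = 4 * (1 - (1 - x ^+ 2)).
  by field; rewrite gt_eqF.
by rewrite -s2; field.
Qed.

Theorem ess_norm_upper (L := lim_dist phi psi) :
  (ess_norm (comp_op phi \- comp_op psi)%R <=
   ((4 - 4 * Num.sqrt (1 - L ^+ 2)) / L)%:E)%E.
Proof.
rewrite -gapE ?lim_dist_ge0 ?lim_dist_le1//.
apply/lee_addgt0Pr => e e0; rewrite -EFinD.
have e4 : 0 < e / 4 by rewrite divr_gt0.
have /cvgrPdist_lt/(_ _ e4) near0 :
    gap (sd d) @[d --> 0^'+] --> gap (lim_dist phi psi).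
  apply: continuous_cvg; [exact: gap_continuous|exact: cvg_sup_dist].
near (0 : R)^'+ => d.
have h1 : `|gap (lim_dist phi psi) - gap (sd d)| < e / 4 by near: d; exact: near0.
have h2 : 0 < d by near: d; exact: nbhs_right_gt.
have h3 : d < 1 by near: d; exact: nbhs_right_lt.
apply: le_trans (ess_norm_le h2 h3 e4) _; rewrite lee_fin.
move: h1; rewrite distrC => h1; have := ler_norm (gap (sd d) - gap (lim_dist phi psi)).
rewrite -/L in h1 *; lra.
Unshelve. all: by end_near. Qed.

End UpperBound.

(** * Peaking test functions *)

Section TestFunctions.
Variables (R : realType) (n : nat).
Local Notation C := R[i].
Local Notation Cn := 'rV[R[i]]_n.
Local Notation HI := (Hinf R n).

Lemma Hinf_extend (g : Cn -> C) : holomorphic_on_polydisc g ->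
  (forall z, polydisc z -> rnorm (g z) <= 1) ->
  exists f : HI, (forall z, polydisc z -> f z = g z) /\ `|f| <= 1.
Proof.
move=> dg g1; pose G := patch (fun=> 0) (@polydisc R n) g.
have GE z : polydisc z -> G z = g z by move=> Dz; rewrite /G /patch mem_set.
have GH : G \in @Hinf_pred R n.
  apply/asboolP; split=> [z Dz||z Dz].
  - apply: (@near_eq_differentiable _ _ _ g); last exact: dg.
    near=> w; rewrite GE//; near: w.
    exact: polydisc_open.
  - by exists 1 => z Dz; rewrite GE//; exact: g1.
  - by rewrite /G /patch memNset.
exists (MkHinf GH); split=> [z Dz|]; first exact: GE.
rewrite -rnormE Hinf_rnorm lecR; apply: Hinf_norm_le => z Dz.
by rewrite [X in rnorm X]GE//; exact: g1.
Unshelve. all: by end_near. Qed.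

Lemma ph_distC (p q : C) : ph_dist p q = ph_dist q p.
Proof.
rewrite /ph_dist !rnormM !rnormV [rnorm (p - q)]rdistC; congr (_ / _).
rewrite -(rnormJ (1 - p^* * q)); congr rnorm.
by case: p q => [a b] [c d]; apply/eqP; rewrite eq_complex /=; apply/andP; split;
  apply/eqP; ring.
Qed.

Section Peak.
Variable u : C.
Hypothesis u1 : rnorm u = 1.

(** A holomorphic coordinate vanishing at the boundary point u and with positive
    real part on the disc. *)
Definition height (x : C) : C := 1 - u^* * x.

Lemma height_Re (x : C) : rnorm x < 1 -> 0 < complex.Re (height x).
Proof.
move=> x1; have := ler_norm (complex.Re (u^* * x)).
have := abs_Re_le (u^* * x); rewrite rnormM rnormJ u1 mul1r.
by rewrite /height raddfB /=; lra.
Qed.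

Lemma height_gt0 (x : C) : rnorm x < 1 -> 0 < rnorm (height x).
Proof.
move=> /height_Re h; apply: lt_le_trans h (le_trans (ler_norm _) (abs_Re_le _)).
Qed.

Lemma rnorm_height (x : C) : rnorm (height x) = rnorm (x - u).
Proof.
have -> : height x = u^* * (u - x).
  by rewrite mulrBr mulJ u1 expr1n.
by rewrite rnormM rnormJ u1 mul1r rdistC.
Qed.

Lemma height_add (a : R) (x : C) : 0 < a -> rnorm x < 1 ->
  a <= rnorm (a%:C + height x) /\ rnorm (height x) <= rnorm (a%:C + height x).
Proof.
move=> a0 /height_Re; move: (height x) => w w0.
have k : rnorm (a%:C + w) ^+ 2 = a ^+ 2 + 2 * a * complex.Re w + rnorm w ^+ 2.
  by rewrite !sqr_rnorm; case: w {w0} => [b c] /=; ring.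
have aw : 0 < a * complex.Re w by rewrite mulr_gt0.
split; rewrite -(@ler_pXn2r _ 2) ?nnegrE ?rnorm_ge0 ?(ltW a0)// k.
  have := sqr_ge0 (rnorm w); lra.
have := sqr_ge0 a; lra.
Qed.

(** Of modulus close to 1 where |height| is between a and b and far from both, and
    small where it is far below a or far above b. *)
Definition peak (a b : R) (x : C) : C :=
  height x / (a%:C + height x) * (b%:C / (b%:C + height x)).

Lemma peak_bound (a b : R) (x : C) : 0 < a -> 0 < b -> rnorm x < 1 ->
  [/\ rnorm (peak a b x) <= 1, rnorm (peak a b x) * a <= rnorm (height x) &
      rnorm (peak a b x) * rnorm (height x) <= b].
Proof.
move=> a0 b0 x1; have [h1 h2] := height_add a0 x1; have [h3 h4] := height_add b0 x1.
have w0 := height_gt0 x1.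
rewrite /peak !rnormM !rnormV rnormR (gtr0_norm b0).
move: (rnorm (height x)) (rnorm (a%:C + _)) (rnorm (b%:C + _)) h1 h2 h3 h4 w0.
move=> w A B h1 h2 h3 h4 w0.
have A0 : 0 < A by lra. have B0 : 0 < B by lra.
have wA : 0 <= w / A <= 1 by rewrite divr_ge0 ?(ltW w0) ?(ltW A0)//= ler_pdivrMr// mul1r.
have bB : 0 <= b / B <= 1 by rewrite divr_ge0 ?(ltW b0) ?(ltW B0)//= ler_pdivrMr// mul1r.
split.
- by case/andP: wA => ? ?; case/andP: bB => ? ?; rewrite mulr_ile1.
- rewrite mulrAC; apply: (@le_trans _ _ (w / A * a)).
    by case/andP: wA => ? ?; case/andP: bB => ? ?; rewrite ler_piMr// mulr_ge0// ltW.
  by rewrite mulrAC ler_pdivrMr// ler_pM2l.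
- rewrite -mulrA; apply: (@le_trans _ _ (b / B * w)).
    case/andP: wA => ? ?; case/andP: bB => ? ?; rewrite ler_piMl// mulr_ge0// ltW//.
  by rewrite mulrAC ler_pdivrMr// ler_pM2l.
Qed.

Lemma peak_large (e b : R) (x : C) : 0 < e -> 0 < b -> rnorm x < 1 ->
  rnorm (height x) <= e * b -> 1 - 2 * e <= rnorm (peak (e * rnorm (height x)) b x).
Proof.
move=> e0 b0 x1 wb; have w0 := height_gt0 x1.
have [a aE] : exists a, a = e * rnorm (height x) by exists (e * rnorm (height x)).
rewrite -aE; have a0 : 0 < a by rewrite aE mulr_gt0.
have := ler_rnormD a%:C (height x); have := ler_rnormD b%:C (height x).
rewrite !rnormR !gtr0_norm//.
have [h1 _] := height_add a0 x1; have [h3 _] := height_add b0 x1.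
rewrite /peak !rnormM !rnormV rnormR (gtr0_norm b0).
move: (rnorm (height x)) (rnorm (a%:C + _)) (rnorm (b%:C + _)) aE wb w0 h1 h3.
move=> w A B aE wb w0 h1 h3 hB hA.
have A0 : 0 < A by lra. have B0 : 0 < B by lra.
have k1 : 1 - e <= w / A.
  by rewrite ler_pdivlMr//; have [h|h] := leP e 1; nra.
have k2 : 1 - e <= b / B.
  by rewrite ler_pdivlMr//; have [h|h] := leP e 1; nra.
have p1 : 0 <= w / A by rewrite divr_ge0 ?ltW.
have p2 : 0 <= b / B by rewrite divr_ge0 ?ltW.
have [h|h] := leP e 1; last first.
  have := mulr_ge0 p1 p2; lra.
have : (1 - e) * (1 - e) <= w / A * (b / B) by rewrite ler_pM ?subr_ge0.
have := mulr_gt0 e0 e0; lra.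
Qed.

Lemma differentiable_peak (a b : R) (l : 'I_n) (z : Cn) : 0 < a -> 0 < b ->
  polydisc z -> differentiable (fun z : Cn => peak a b (z ord0 l)) z.
Proof.
move=> a0 b0 /polydiscP z1.
have dh : differentiable (fun z : Cn => height (z ord0 l)) z.
  apply: differentiableB; first exact: differentiable_cst.
  by apply: differentiableM; [exact: differentiable_cst|exact: differentiable_coord].
have nz c : 0 < c -> c%:C + height (z ord0 l) != 0.
  by move=> c0; rewrite -rnorm_gt0; have [+ _] := height_add c0 (z1 l); exact: lt_le_trans.
have dV c : 0 < c -> differentiable (fun z : Cn => (c%:C + height (z ord0 l))^-1) z.
  move=> c0; apply: differentiableV; last exact: nz.
  by apply: differentiableD; first exact: differentiable_cst.
apply: differentiableM; apply: differentiableM;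
  [exact: dh|exact: dV|exact: differentiable_cst|exact: dV].
Qed.

End Peak.

Lemma differentiable_mobius (q : C) (j : 'I_n) (z : Cn) : rnorm q < 1 ->
  polydisc z -> differentiable (fun z : Cn => (q - z ord0 j) / (1 - q^* * z ord0 j)) z.
Proof.
move=> q1 /polydiscP z1; have dc := @differentiable_coord C 1 n z ord0 j.
apply: differentiableM; first exact: differentiableB.
apply: differentiableV; last exact: mobius_den.
apply: differentiableB; first exact: differentiable_cst.
by apply: differentiableM; first exact: differentiable_cst.
Qed.

End TestFunctions.

(** * The lower bound *)

Section LowerBound.
Variables (R : realType) (n : nat) (phi psi : polydisc_selfmap R n).
Local Notation C := R[i].
Local Notation Cn := 'rV[R[i]]_n.
Local Notation HI := (Hinf R n).
Local Notation L := (lim_dist phi psi).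

Definition side_value (l : 'I_n) (z : Cn) (p : C) : Prop :=
  p = phi z ord0 l \/ p = psi z ord0 l.

(** The coordinate l that approaches the boundary may depend on d; as the sets E_d
    are nested, one of the finitely many coordinates works for all d. *)
Lemma far_near_boundary (M : R) : 0 <= M -> M < L -> exists l : 'I_n, forall d : R, 0 < d ->
  exists z p, [/\ polydisc z, M < max_dist phi psi z, side_value l z p & 1 - d < rnorm p].
Proof.
move=> M0 ML; apply: contrapT => /forallNP noL.
have bad l : exists d : R, 0 < d /\ forall z p, polydisc z -> M < max_dist phi psi z ->
    side_value l z p -> rnorm p <= 1 - d.
  have /existsNP[d /not_implyP[d0 nd]] := noL l; exists d; split=> // z p Dz Mz pz.
  by rewrite leNgt; apply/negP => dp; apply: nd; exists z, p.
have [d dP] := choice bad.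
pose e := \big[Num.min/1]_(l < n) d l.
have e0 : 0 < e by apply/bigmin_gtP; split=> // l _; exact: (dP l).1.
have supM : M < sup_dist phi psi e by exact: lt_le_trans ML (lim_dist_le _ _ e0).
have E0 : Edelta phi psi e !=set0.
  apply/set0P/eqP => E0; move: supM.
  by rewrite /sup_dist E0 image_set0 sup0 ltNge M0.
have [_ [z [l _ [Dz ez]] <-] Mz] : exists2 x,
    [set max_dist phi psi z | z in Edelta phi psi e] x & M < x.
  by apply: sup_gt => //; case: E0 => z Ez; exists (max_dist phi psi z), z.
have el : e <= d l by exact: bigmin_le.
have := (dP l).2 z _ Dz Mz; move=> h.
have h1 := h _ (or_introl erefl); have h2 := h _ (or_intror erefl).
move: ez; rewrite lt_max => /orP[]; lra.
Qed.

Lemma boundary_cluster (M : R) : 0 <= M -> M < L -> exists (l : 'I_n) (u : C), rnorm u = 1 /\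
  forall e : R, 0 < e -> exists z p,
    [/\ polydisc z, M < max_dist phi psi z, side_value l z p & rnorm (p - u) < e].
Proof.
move=> M0 ML; have [l lP] := far_near_boundary M0 ML; exists l.
pose A (d : R) := [set p : C | 1 - d < rnorm p /\ exists z,
  [/\ polydisc z, M < max_dist phi psi z & side_value l z p]].
pose F := filter_from [set d : R | 0 < d] A.
have FF : ProperFilter F.
  apply: filter_from_proper.
    apply: filter_from_filter; first by exists 1 => /=.
    move=> i j i0 j0; exists (Num.min i j); first by rewrite /= lt_min i0.
    have mi : Num.min i j <= i by rewrite ge_min lexx.
    have mj : Num.min i j <= j by rewrite ge_min lexx orbT.
    by move=> p [pd pz]; split; split=> //; lra.
  by move=> d /lP[z [p [Dz Mz pz dp]]]; exists p; split=> //; exists z.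
have FB : F [set p : C | rnorm p <= 1].
  exists 1 => //= p [_ [z [Dz _ pz]]]; apply: ltW.
  by case: pz => ->; apply: (iffLR (polydiscP _)); exact: selfmap_polydisc.
have [u [u1 uF]] := @compact_disc R 1 F FF FB; exists u.
have close e : 0 < e -> \forall p \near u, rnorm (p - u) < e.
  by move=> e0; apply/near_rnorm; exists e.
have FA d : 0 < d -> F (A d) by move=> d0; exists d.
split; last first.
  move=> e e0; have [p [[_ [z [Dz Mz pz]]] pu]] := uF _ _ (FA 1 ltr01) (close e e0).
  by exists z, p.
apply/eqP; rewrite eq_le u1 /= leNgt; apply/negP => ult.
have d0 : 0 < (1 - rnorm u) / 2 by rewrite divr_gt0// subr_gt0.
have [p [[dp _] pu]] := uF _ _ (FA _ d0) (close _ d0).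
have := ler_rnormD (p - u) u; rewrite subrK => h.
by move: dp pu => /=; lra.
Qed.

Section FixedCluster.
Variables (M : R) (l : 'I_n) (u : C).
Hypotheses (M0 : 0 <= M) (u1 : rnorm u = 1).
Hypothesis cluster_u : forall e : R, 0 < e -> exists z p,
    [/\ polydisc z, M < max_dist phi psi z, side_value l z p & rnorm (p - u) < e].

(** Whichever of phi_l z0 and psi_l z0 is the point p near u, the automorphism in
    the coordinate j vanishes at the j-th coordinate of the other image, so only
    the value at p survives in f (phi z0) - f (psi z0). *)
Lemma test_function (e b : R) : 0 < e -> 0 < b -> exists (f : HI) (a : R) (z0 : Cn),
  [/\ 0 < a, polydisc z0, `|f| <= 1,
   (forall z, polydisc z ->
     rnorm (f z) * a <= rnorm (height u (z ord0 l)) /\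
     rnorm (f z) * rnorm (height u (z ord0 l)) <= b) &
   (1 - 2 * e) * M <= rnorm (f (phi z0) - f (psi z0))].
Proof.
move=> e0 b0; have [z0 [p [Dz Mz pz pu]]] := cluster_u (mulr_gt0 e0 b0).
have /polydiscP pD := selfmap_polydisc phi Dz.
have /polydiscP qD := selfmap_polydisc psi Dz.
have [j Mj] : exists j, M < ph_dist (phi z0 ord0 j) (psi z0 ord0 j).
  apply: contrapT => /forallNP nj; move: Mz; rewrite ltNge => /negP; apply.
  by apply/bigmax_leP; split=> // j _; rewrite leNgt; apply/negP; exact: nj.
have p1 : rnorm p < 1 by case: pz => ->.
pose a := e * rnorm (height u p).
have a0 : 0 < a by rewrite mulr_gt0// height_gt0.
have hp : rnorm (height u p) <= e * b by rewrite rnorm_height// ltW.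
have big := peak_large u1 e0 b0 p1 hp; rewrite -/a in big.
have mk (q : C) : rnorm q < 1 -> exists f : HI, (forall z, polydisc z ->
    f z = peak u a b (z ord0 l) * ((q - z ord0 j) / (1 - q^* * z ord0 j))) /\ `|f| <= 1.
  move=> q1; apply: Hinf_extend => z Dz'.
    by apply: differentiableM; [exact: differentiable_peak|exact: differentiable_mobius].
  have /polydiscP z1 := Dz'.
  rewrite rnormM mulr_ile1 ?rnorm_ge0//; first by case: (peak_bound u1 a0 b0 (z1 l)).
  exact: (ltW (ph_dist_lt1 q1 (z1 j))).
have bnd q (f : HI) : rnorm q < 1 -> (forall z, polydisc z ->
    f z = peak u a b (z ord0 l) * ((q - z ord0 j) / (1 - q^* * z ord0 j))) ->
    forall z, polydisc z -> rnorm (f z) * a <= rnorm (height u (z ord0 l)) /\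
     rnorm (f z) * rnorm (height u (z ord0 l)) <= b.
  move=> q1 fE z Dz'; have /polydiscP z1 := Dz'; rewrite fE// rnormM.
  have [_ k1 k2] := peak_bound u1 a0 b0 (z1 l).
  have m1 : rnorm ((q - z ord0 j) / (1 - q^* * z ord0 j)) <= 1 by exact: (ltW (ph_dist_lt1 q1 (z1 j))).
  split; rewrite mulrAC.
    by apply: le_trans k1; rewrite ler_piMr// mulr_ge0 ?rnorm_ge0// ltW.
  by apply: le_trans k2; rewrite ler_piMr// mulr_ge0 ?rnorm_ge0.
have fin x : M < x -> (1 - 2 * e) * M <= rnorm (peak u a b p) * x.
  move=> Mx; apply: (@le_trans _ _ (rnorm (peak u a b p) * M)).
    by rewrite ler_wpM2r.
  by rewrite ler_wpM2l ?rnorm_ge0// ltW.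
have [pE|pE] := pz.
- have [f [fE f1]] := mk _ (qD j); exists f, a, z0; split=> //; first exact: bnd (qD j) fE.
  rewrite !fE; [|exact: selfmap_polydisc|exact: selfmap_polydisc].
  rewrite subrr mul0r mulr0 subr0 -pE rnormM; apply: fin.
  by rewrite [rnorm _]ph_distC.
- have [f [fE f1]] := mk _ (pD j); exists f, a, z0; split=> //; first exact: bnd (pD j) fE.
  rewrite !fE; [|exact: selfmap_polydisc|exact: selfmap_polydisc].
  by rewrite subrr mul0r mulr0 sub0r rnormN -pE rnormM; apply: fin.
Qed.

(** The images under K of a sequence of test functions concentrating at u have a
    cluster point, so two of them, f first and g arbitrarily late, have nearly
    equal images.  When g lives close enough to u, at each point one of |f| and |g|
    is at most e. *)
Lemma separated_pair (K : {linear HI -> HI}) (e : R) : compact_op K -> 0 < e ->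
  exists (f g : HI) (z0 : Cn), [/\ polydisc z0,
    forall z, rnorm ((f - g) z) <= 1 + e, rnorm (K (f - g)) <= 2 * e,
    rnorm (g (phi z0)) <= e /\ rnorm (g (psi z0)) <= e &
    (1 - 2 * e) * M <= rnorm (f (phi z0) - f (psi z0))].
Proof.
move=> [U KU [cU _]] e0.
have /choice[f fP] (k : nat) : exists f : HI, exists (a : R) (z0 : Cn),
  [/\ 0 < a, polydisc z0, `|f| <= 1,
   (forall z, polydisc z ->
     rnorm (f z) * a <= rnorm (height u (z ord0 l)) /\
     rnorm (f z) * rnorm (height u (z ord0 l)) <= k.+1%:R^-1) &
   (1 - 2 * e) * M <= rnorm (f (phi z0) - f (psi z0))].
  by apply: test_function => //; rewrite invr_gt0.
pose F : set_system HI := (fun k => K (f k)) @ \oo.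
have FF : ProperFilter F by exact: fmap_proper_filter.
have KfU : F U.
  by exists 0%N => // k _; apply: KU; exists (f k) => //; have [a [z0 []]] := fP k.
have [h [_ hK]] := cU F FF KfU.
have near_h : \forall y \near h, rnorm (y - h) < e by apply/near_rnorm; exists e.
have freq N : exists2 k, (N <= k)%N & rnorm (K (f k) - h) < e.
  have tail : F [set y | exists2 k, (N <= k)%N & y = K (f k)].
    by exists N => // k Nk; exists k.
  by have [y [[k Nk ->] yh]] := hK _ _ tail near_h; exists k.
have [k _ kh] := freq 0%N; have [a [z0 [a0 Dz f1 fb fM]]] := fP k.
have /polydiscP pD := selfmap_polydisc phi Dz.
have /polydiscP qD := selfmap_polydisc psi Dz.
pose m := Num.min (e ^+ 2 * a)
  (Num.min (e * rnorm (height u (phi z0 ord0 l))) (e * rnorm (height u (psi z0 ord0 l)))).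
have m0 : 0 < m by rewrite !lt_min !mulr_gt0 ?exprn_gt0 ?height_gt0.
have [k' Nk' kh'] := freq (Num.truncn m^-1).
have b'm : k'.+1%:R^-1 <= m.
  rewrite -[leRHS]invrK lef_pV2 ?posrE ?invr_gt0//.
  by rewrite (le_trans (ltW (truncnS_gt _)))// ler_nat ltnS.
have [a' [z' [_ _ g1 gb _]]] := fP k'; move: b'm; rewrite !le_min => /and3P[m1 m2 m3].
have fk1 z : rnorm (f k z) <= 1 by move: z; exact/Hinf_ball.
have gk1 z : rnorm (f k' z) <= 1 by move: z; exact/Hinf_ball.
have small w : polydisc w -> k'.+1%:R^-1 <= e * rnorm (height u (w ord0 l)) ->
    rnorm (f k' w) <= e.
  move=> Dw hw; have /polydiscP w1 := Dw; have w0 := height_gt0 u1 (w1 l).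
  by rewrite -(ler_pM2r w0); apply: le_trans hw; case: (gb w Dw).
exists (f k), (f k'), z0; split=> //.
- move=> z; have [Dw|nD] := pselect (polydisc z); last first.
    by rewrite HinfB !Hinf_out// subrr rnorm0 addr_ge0// ltW.
  rewrite HinfB; apply: le_trans (ler_rnormB _ _) _.
  have /polydiscP w1 := Dw; have w0 := height_gt0 u1 (w1 l).
  have [h1 h2] := fb z Dw.
  have [le1|lt1] := leP (rnorm (height u (z ord0 l))) (e * a).
    have : rnorm (f k z) <= e by rewrite -(ler_pM2r a0); exact: le_trans le1.
    by move=> fe; rewrite addrC lerD.
  have : rnorm (f k' z) <= e.
    apply: small => //; apply: le_trans m1 _; rewrite expr2 -mulrA.
    by rewrite ler_pM2l// ltW.
  by move=> ge; rewrite lerD.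
- rewrite linearB; have -> : K (f k) - K (f k') = (K (f k) - h) - (K (f k') - h).
    by rewrite opprB addrA subrK.
  move: (K (f k) - h) (K (f k') - h) kh kh' => X Y Xe Ye.
  by rewrite (le_trans (ler_rnormB X Y))// mulr_natl mulr2n lerD// ltW.
- by split; apply: small => //; exact: selfmap_polydisc.
Qed.

(** The operator is tested on (f - g) / (1 + e), which lies in the unit ball. *)
Lemma op_norm_ge (K : {linear HI -> HI}) (e : R) : M <= 1 -> compact_op K -> 0 < e ->
  ((M - 7 * e)%:E <= op_norm ((comp_op phi \- comp_op psi) \- K)%R)%E.
Proof.
move=> M1 cK e0.
have key : (M - 7 * e) * (1 + e) <= (1 - 2 * e) * M - 2 * e - 2 * e.
  have ee := sqr_ge0 e.
  have eM : 0 <= e * (1 - M) by rewrite mulr_ge0 ?subr_ge0// ltW.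
  by lra.
have [f [g [z0 [Dz fg1 Kfg [gp gq] fM]]]] := separated_pair cK e0.
have e1 : 0 < 1 + e by rewrite addr_gt0.
pose c : C := ((1 + e)^-1)%:C.
have nc : rnorm c = (1 + e)^-1 by rewrite rnormR gtr0_norm// invr_gt0.
pose x : HI := c *: (f - g).
have x1 : `|x| <= 1.
  apply/Hinf_ball => z; rewrite [X in rnorm X](_ : _ = c *: (f - g) z)// rnormZ nc.
  by rewrite mulrC ler_pdivrMr// mul1r.
pose T : {linear HI -> HI} := (comp_op phi \- comp_op psi)%R.
have Tz : rnorm (T (f - g)) >= (1 - 2 * e) * M - 2 * e.
  apply: le_trans (Hinf_norm_ub _ z0).
  have -> : T (f - g) z0 = (f (phi z0) - f (psi z0)) - (g (phi z0) - g (psi z0)).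
    rewrite -[LHS]/(comp_op phi (f - g) z0 - comp_op psi (f - g) z0).
    by rewrite !comp_opE// !HinfB; ring.
  set A := f (phi z0) - _ in fM *; set B := g (phi z0) - _.
  have := ler_rnormD (A - B) B; rewrite subrK.
  have : rnorm B <= 2 * e by apply: le_trans (ler_rnormB _ _) _; lra.
  lra.
apply: le_trans (ereal_sup_ubound _); last by exists x.
rewrite lee_fin; have -> : ((comp_op phi \- comp_op psi) \- K)%R x =
    c *: (T (f - g) - K (f - g)).
  have Tx : T x = c *: T (f - g) by exact: linearZ.
  have Kx : K x = c *: K (f - g) by exact: linearZ.
  by rewrite -[LHS]/(T x - K x) Tx Kx (scalerBr c (T (f - g)) (K (f - g))).
rewrite rnormZ nc [(1 + e)^-1 * _]mulrC ler_pdivlMr//; apply: le_trans key _.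
have := ler_rnormD (T (f - g) - K (f - g)) (K (f - g)); rewrite subrK.
move: (rnorm (T (f - g) - _)) (rnorm (T (f - g))) (rnorm (K (f - g))) Tz Kfg.
by move=> A B D; lra.
Qed.

End FixedCluster.

Theorem ess_norm_lower :
  ((lim_dist phi psi)%:E <= ess_norm (comp_op phi \- comp_op psi)%R)%E.
Proof.
apply: le_ereal_inf_tmp => _ [K cK <-].
apply/lee_addgt0Pr => e e0.
have [Le|Le] := leP L (e / 2).
  apply: (@le_trans _ _ (0 + e%:E)%E); first by rewrite add0e lee_fin; lra.
  rewrite leeD2r//; apply: le_trans (ereal_sup_ubound _); last by exists 0; rewrite //= normr0.
  by rewrite lee_fin rnorm_ge0.
have M0 : 0 <= L - e / 2 by lra.
have ML : L - e / 2 < L by lra.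
have [l [u [u1 uP]]] := boundary_cluster M0 ML.
have e16 : 0 < e / 16 by rewrite divr_gt0.
have L1 := lim_dist_le1 phi psi; have M1 : L - e / 2 <= 1 by lra.
have := op_norm_ge M0 u1 uP M1 cK e16; move=> /(leeD2r e%:E); apply: le_trans.
by rewrite -EFinD lee_fin; lra.
Qed.

End LowerBound.

(* When L = 0 the upper bound reads 0 / 0, which is 0 since x / 0 = 0. *)
Theorem mainTheorem1 (R : realType) (n : nat) (n_ge1 : (1 <= n)%N)
    (phi psi : polydisc_selfmap R n) :
  let L := lim_dist phi psi in
  (L%:E <= ess_norm (comp_op phi \- comp_op psi)%R
        <= ((4 - 4 * Num.sqrt (1 - L ^+ 2)) / L)%:E)%E.
Proof. by move=> /=; apply/andP; split; [exact: ess_norm_lower|exact: ess_norm_upper]. Qed.
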